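(* Let $R^4\subset\mathbb{P}^5$ be the image of $\mathbb{P}^1\times\mathbb{P}^1$ embedded by the complete linear system $|\mathcal{O}_{\mathbb{P}^1\times\mathbb{P}^1}(1,2)|$, and let $M_4$ be the variety of secant and tangent lines of $R^4$, regarded as a subvariety of the Grassmannian $M_8^{14}\subset\mathbb{P}^{14}$ of lines in $\mathbb{P}^5$. Then $M_4\subset M_8^{14}$ is an irreducible smooth variety of dimension $4$.
   Context: Everything is over $\mathbb{C}$. The embedding of $\mathbb{P}^1\times\mathbb{P}^1$ with coordinates $([x_0,x_1],[y_0,y_1])$ into $\mathbb{P}^5$ with coordinates $[z_{ij}]$, $i\in\{0,1\}$, $j\in\{0,1,2\}$, is $z_{ij}=x_i y_0^{2-j}y_1^j$; its image is the rational normal scroll $R^4$ of degree $4$. $M_8^{14}\subset\mathbb{P}^{14}$ denotes the Grassmannian of lines in $\mathbb{P}^5$ in its Plücker embedding (dimension $8$, degree $14$). $M_4$ is the set of all lines $\ell\subset\mathbb{P}^5$ that are chords of $R^4$ in the broad sense (secant or tangent), i.e. such that the scheme $\ell\cap R^4$ contains a subscheme of length $2$ (lines contained in $R^4$ included), with its reduced structure. *)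

(* Defs.v *)
From mathcomp Require Import all_boot all_order all_algebra.
From mathcomp Require Import reals complex.
From mathcomp Require Import mpoly.

Set Implicit Arguments.
Unset Strict Implicit.
Unset Printing Implicit Defensive.

Import GRing.Theory.
Local Open Scope ring_scope.

Section ProjectiveGeometry.
Variable F : fieldType.

(* [proj n] is P^n(F): the lines through the origin of F^(n+1). *)
Definition proj (n : nat) := {L : {vspace 'rV[F]_n.+1} | \dim L == 1%N}.

(* Lines of P^n, i.e. planes through the origin of F^(n+1). *)
Definition pline (n : nat) := {l : {vspace 'rV[F]_n.+1} | \dim l == 2%N}.

Definition on_line n (l : pline n) (P : proj n) : Prop :=
  (val P <= val l)%VS.

Definition psub n (X Y : proj n -> Prop) : Prop := forall P, X P -> Y P.

Definition is_form n (f : {mpoly F[n.+1]}) : Prop := exists d, f \is d.-homog.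

Definition vanishes_at n (f : {mpoly F[n.+1]}) (P : proj n) : Prop :=
  forall v, v \in val P -> f.@[v ord0] = 0.

(* The forms in the homogeneous ideal I(X). *)
Definition form_on n (X : proj n -> Prop) (f : {mpoly F[n.+1]}) : Prop :=
  is_form f /\ forall P, X P -> vanishes_at f P.

Definition zclosed n (X : proj n -> Prop) : Prop :=
  exists S : {mpoly F[n.+1]} -> Prop,
    (forall f, S f -> is_form f) /\
    (forall P, X P <-> forall f, S f -> vanishes_at f P).

Definition zirreducible n (X : proj n -> Prop) : Prop :=
  (exists P, X P) /\
  forall A B, zclosed A -> zclosed B ->
    psub X (fun P => A P \/ B P) -> psub X A \/ psub X B.

(* Z 0 < Z 1 < ... < Z k strictly increasing irreducible closed subsets of X
   (for X closed, closed in X is the same as closed in P^n). *)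
Definition irr_chain n (X : proj n -> Prop) (k : nat)
    (Z : nat -> proj n -> Prop) : Prop :=
  (forall i, (i <= k)%N -> [/\ zclosed (Z i), zirreducible (Z i) & psub (Z i) X])
  /\ (forall i, (i < k)%N -> psub (Z i) (Z i.+1) /\ ~ psub (Z i.+1) (Z i)).

(* Krull dimension of a closed subset X. *)
Definition has_dim n (X : proj n -> Prop) (d : nat) : Prop :=
  (exists Z, irr_chain X d Z) /\
  (forall k Z, irr_chain X k Z -> (k <= d)%N).

(* Vectors of the affine cone over the embedded projective tangent space of X
   (with its reduced structure) at P. This is the kernel of the Jacobian matrix
   of the whole ideal I(X) at P; it contains P by Euler's relation, and the
   Zariski tangent space of X at P is its quotient by P. *)
Definition tangent_vector n (X : proj n -> Prop) (P : proj n)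
    (v : 'rV[F]_n.+1) : Prop :=
  forall f, form_on X f -> forall p, p \in val P ->
    \sum_(i < n.+1) (f^`M(i)).@[p ord0] * v ord0 i = 0.

Definition tangent_space_dim n (X : proj n -> Prop) (P : proj n) (d : nat) :=
  exists T : {vspace 'rV[F]_n.+1},
    (forall v, v \in T <-> tangent_vector X P v) /\ \dim T = d.+1.

(* Smoothness of an irreducible closed X: every Zariski tangent space has
   dimension dim X. *)
Definition smooth n (X : proj n -> Prop) : Prop :=
  exists d, has_dim X d /\ forall P, X P -> tangent_space_dim X P d.

Definition homog_ideal n (K : {mpoly F[n.+1]} -> Prop) : Prop :=
  [/\ K 0,
      forall f g, K f -> K g -> K (f + g),
      forall f g, K g -> K (f * g)
    & forall d f, K f -> K (pihomog mdeg d f)].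

(* The degree d part of F[z]/K has dimension m. *)
Definition hilbert_fun n (K : {mpoly F[n.+1]} -> Prop) (d m : nat) : Prop :=
  exists U : {vspace dhomog n.+1 F d},
    (forall f : dhomog n.+1 F d, f \in U <-> K (f : {mpoly F[n.+1]})) /\
    (\dim U + m)%N = \dim {:dhomog n.+1 F d}.

(* A homogeneous ideal K stands for the closed subscheme Proj (F[z]/K) of P^n.
   It is finite of length m iff its Hilbert polynomial is the constant m. *)
Definition subscheme_length n (K : {mpoly F[n.+1]} -> Prop) (m : nat) : Prop :=
  exists d0, forall d, (d0 <= d)%N -> hilbert_fun K d m.

(* The scheme l :&: X (X reduced) is cut out by I(l) + I(X); its closed
   subschemes are given by the homogeneous ideals K containing both. *)
Definition is_chord n (X : proj n -> Prop) (l : pline n) : Prop :=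
  exists K : {mpoly F[n.+1]} -> Prop,
    [/\ homog_ideal K,
        forall f, form_on (on_line l) f -> K f,
        forall f, form_on X f -> K f
      & subscheme_length K 2].

(* The point ([x_0,x_1],[y_0,y_1]) goes to z_ij = x_i y_0^(2-j) y_1^j; the
   coordinate z_ij is the one of index 3 i + j. *)
Definition scroll_vec (x y : 'rV[F]_2) : 'rV[F]_6 :=
  \row_(k < 6) (x ord0 (inord (k %/ 3)) *
    y ord0 ord0 ^+ (2 - k %% 3) * y ord0 ord_max ^+ (k %% 3)).

Definition R4 (P : proj 5) : Prop :=
  exists x y : 'rV[F]_2,
    [/\ x != 0, y != 0 & val P = <[scroll_vec x y]>%VS].

(* The 15 pairs (i, j) with i < j < 6, in lexicographic order. *)
Definition plucker_pairs : seq (nat * nat) :=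
  [seq (i, j) | i <- iota 0 6, j <- iota i.+1 (5 - i)].

Definition wedge (u v : 'rV[F]_6) : 'rV[F]_15 :=
  \row_(k < 15)
    let: (i, j) := nth (0, 0)%N plucker_pairs k in
    u ord0 (inord i) * v ord0 (inord j) - u ord0 (inord j) * v ord0 (inord i).

(* P is the Pluecker point of l, i.e. spanned by u /\ v for a basis (u, v). *)
Definition plucker_point (l : pline 5) (P : proj 14) : Prop :=
  exists u v, val l = <<[:: u; v]>>%VS /\ val P = <[wedge u v]>%VS.

(* M_8^14, the Grassmannian of lines of P^5. *)
Definition grassmannian (P : proj 14) : Prop :=
  exists l : pline 5, plucker_point l P.

Definition M4 (P : proj 14) : Prop :=
  exists l : pline 5, is_chord R4 l /\ plucker_point l P.

End ProjectiveGeometry.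

(* Main.v *)
From HB Require Import structures.
Require Import Defs.
From mathcomp Require Import all_boot all_order all_algebra.
From mathcomp Require Import boolp reals complex.
From mathcomp Require Import mpoly ring.

Set Implicit Arguments.
Unset Strict Implicit.
Unset Printing Implicit Defensive.

Import GRing.Theory Num.Theory.
Local Open Scope ring_scope.

(* M4 is a quadric bundle over the dual plane. Write R4 as the image of
   (x, y) |-> x (x) y^2 in P(U (x) S^2 V), with U, V of dimension 2. A chord
   through x (x) y^2 and x' (x) y'^2 is determined by q = y y' in S^2 V,
   l = [x, x'] / 2 and t = [y, y'] x x' in S^2 U, which are related by
   disc t = 4 l^2 disc q; conversely every (q, l, t) with q <> 0, (l, t) <> 0 on
   this hypersurface is reached, tangent lines and rulings included, and the
   Pluecker coordinates of the chord are linear combinations of the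
   l q_j q_k and t_i q_j. So M4 is the image of the hypersurface under psi.
   - Chords: the ideal of a length 2 scheme has codimension 2 on binary forms
     of large degree, so the quadrics containing R4 restrict to the line as
     multiples of one of them. Hence the line contains two points of R4, or is
     tangent to R4 at one; both cases are explicit.
   - Equations: the l q_j q_k and t_i q_j fill a 3 x 6 matrix of rank 1 with a
     symmetric block, and the hypersurface equation gives further quadrics.
   - Irreducibility and tangent spaces: two points, or a point and a tangent
     direction, lie on a curve T^2 = delta(e) with delta of odd degree; its
     coordinate ring is a domain and equations vanishing on it are multiples
     of T^2 - delta. The Jacobian of the quadrics gives the opposite bound on
     the tangent spaces.
   - Dimension: on the dense chart q_0 = l = 1, a copy of the affine 4-space,
     counting monomials produces an algebraic relation between any 5 forms and
     a linear form; peeling it off along a chain of irreducible closed sets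
     bounds the length of the chain by 4. *)

(** * Substitution in multivariate polynomials *)

Section Substitution.

Lemma mpoly_ring_ind n (R : comNzRingType) (P : {mpoly R[n]} -> Prop) :
    (forall a, P a%:MP) -> (forall i, P 'X_i) ->
    (forall f g, P f -> P g -> P (f + g)) ->
    (forall f g, P f -> P g -> P (f * g)) ->
  forall f, P f.
Proof.
move=> PC PX PD PM f.
have P1 : P 1 by rewrite -mpolyC1.
elim/mpolyind: f => [|a m f _ _ IH]; first by rewrite -mpolyC0.
apply: PD IH; rewrite -mul_mpolyC; apply: (PM _ _) => //.
rewrite mpolyXE_id; apply: (big_ind P P1 PM) => i _.
by elim: (m i) => [|k IH]; rewrite ?expr0 ?exprS //; apply: (PM _ _).
Qed.

Lemma rmorph_mmap n (R S S' : comNzRingType) (phi : {rmorphism R -> S})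
    (psi : {rmorphism S -> S'}) (c : 'I_n -> S) (f : {mpoly R[n]}) :
  psi (mmap phi c f) = mmap (psi \o phi) (psi \o c) f.
Proof.
rewrite /mmap rmorph_sum; apply: eq_bigr => m _.
rewrite rmorphM /mmap1 rmorph_prod; congr (_ * _).
by apply: eq_bigr => i _; rewrite rmorphXn.
Qed.

Lemma eq_mmap n (R S : comNzRingType) (phi phi' : R -> S) (c c' : 'I_n -> S)
    (f : {mpoly R[n]}) :
  phi =1 phi' -> c =1 c' -> mmap phi c f = mmap phi' c' f.
Proof.
move=> Ephi Ec; rewrite /mmap; apply: eq_bigr => m _.
by rewrite Ephi; congr (_ * _); apply: mmap1_eq.
Qed.

Lemma mmap_homogZ n (R S : comNzRingType) (phi : R -> S)
    (c : 'I_n -> S) (f : {mpoly R[n]}) d a : f \is d.-homog ->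
  mmap phi (fun i => a * c i) f = a ^+ d * mmap phi c f.
Proof.
move=> /dhomogP fd; rewrite /mmap big_distrr [RHS]big_seq [LHS]big_seq /=.
apply: eq_bigr => m /fd md; rewrite mulrCA; congr (_ * _).
have {md} <- : mdeg m = d := md; rewrite /mmap1 mdegE expr_sum -big_split.
by apply: eq_bigr => i _; rewrite exprMn.
Qed.

Lemma meval_homogZ n (R : comNzRingType) (v : 'I_n -> R) (f : {mpoly R[n]}) d a :
  f \is d.-homog -> f.@[fun i => a * v i] = a ^+ d * f.@[v].
Proof. exact: mmap_homogZ. Qed.

Lemma mmap_hornerE n (R : comNzRingType) (c : 'I_n -> {poly R})
    (f : {mpoly R[n]}) a :
  (mmap polyC c f).[a] = f.@[fun i => (c i).[a]].
Proof.
rewrite -[LHS]/(horner_eval a _) rmorph_mmap.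
by apply: eq_mmap => x //=; rewrite /horner_eval hornerC.
Qed.

(** Chain rule. Both sides satisfy the Leibniz rule as functions of f, so constants and variables
    suffice. *)
Lemma deriv_mmap n (R : comNzRingType) (c : 'I_n -> {poly R})
    (f : {mpoly R[n]}) :
  (mmap polyC c f)^`() = \sum_i mmap polyC c f^`M(i) * (c i)^`().
Proof.
elim/mpoly_ring_ind: f => [a|j|f g IHf IHg|f g IHf IHg].
- rewrite mmapC derivC big1 // => i _; by rewrite mderivC mmap0 mul0r.
- rewrite mmapX mmap1U (bigD1 j) //= big1 ?addr0 => [|i ij].
    rewrite mderivX mnm1E eqxx scale1r.
    have -> : (U_(j) - U_(j))%MM = 0%MM.
      by apply/mnmP => i; rewrite mnmBE subnn mnm0E.
    by rewrite mpolyX0 rmorph1 mul1r.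
  by rewrite mderivX mnm1E eq_sym (negPf ij) scale0r mmap0 mul0r.
- rewrite mmapD derivD IHf IHg -big_split /=; apply: eq_bigr => i _.
  by rewrite mderivD mmapD mulrDl.
rewrite rmorphM /= derivM IHf IHg mulr_suml mulr_sumr -big_split /=.
by apply: eq_bigr => i _; rewrite mderivM mmapD !rmorphM; ring.
Qed.

(** First order Taylor coefficient of f along the curve c: the link between Jacobians and
    computations with 1-jets. *)
Lemma deriv_mmap0 n (R : comNzRingType) (c : 'I_n -> {poly R})
    (f : {mpoly R[n]}) :
  (mmap polyC c f)`_1 = \sum_i (f^`M(i)).@[fun j => (c j)`_0] * (c i)`_1.
Proof.
have coef1 (p : {poly R}) : p`_1 = p^`().[0].
  by rewrite horner_coef0 coef_deriv mulr1n.
rewrite coef1 deriv_mmap horner_sum; apply: eq_bigr => i _.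
rewrite hornerM mmap_hornerE coef1; congr (_ * _).
by apply: meval_eq => j; rewrite horner_coef0.
Qed.

(** In characteristic 0 the natural numbers supply more distinct roots than a nonzero polynomial can
    have. *)
Lemma poly_zero_fun (F : numFieldType) (p : {poly F}) : (forall a, p.[a] = 0) -> p = 0.
Proof.
move=> p0; apply/eqP/negPn/negP => nzp.
have := @max_poly_roots _ p [seq i%:R | i <- iota 0 (size p)] nzp.
rewrite size_map size_iota ltnn => H; suff: false by []; apply: H.
  by apply/allP => x _; apply/eqP/p0.
by rewrite map_inj_uniq ?iota_uniq // => i j /eqP; rewrite eqr_nat => /eqP.
Qed.

End Substitution.

(** * Points and irreducible closed sets of projective space *)

Section ProjectivePoints.
Variables (F : fieldType) (n : nat).
Implicit Types (P : proj F n) (u v : 'rV[F]_n.+1) (f g : {mpoly F[n.+1]}).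

Lemma proj_of_vec u : u != 0 -> exists P : proj F n, val P = <[u]>%VS.
Proof.
move=> nzu; have Hd : \dim <[u]>%VS == 1%N by rewrite dim_vline nzu.
by exists (exist _ <[u]>%VS Hd).
Qed.

Lemma proj_vec_neq0 P u : val P = <[u]>%VS -> u != 0.
Proof.
move=> EP; have := svalP P; rewrite -[sval P]/(val P) EP dim_vline.
by case: (u == 0).
Qed.

Lemma proj_vecP P : exists u, val P = <[u]>%VS.
Proof.
have dP : \dim (val P) = 1%N by apply/eqP/(svalP P).
exists (vpick (val P)); apply/eqP; rewrite eq_sym eqEdim -memvE memv_pick.
by rewrite dim_vline vpick0 -dimv_eq0 dP.
Qed.

Lemma vanishes_atE f d P u : f \is d.-homog -> val P = <[u]>%VS ->
  vanishes_at f P <-> f.@[u ord0] = 0.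
Proof.
move=> fd EP; split=> [f0|f0 v]; first by apply: f0; rewrite EP memv_line.
rewrite EP => /vlineP[a ->].
rewrite (meval_eq (v2 := fun i => a * u ord0 i)) => [|i]; last by rewrite mxE.
by rewrite (meval_homogZ _ _ fd) f0 mulr0.
Qed.

Lemma zclosed_vanishes f : is_form f -> zclosed (vanishes_at f).
Proof.
move=> ff; exists (eq f); split=> [g <- //|P]; split=> [f0 g <- //|].
by apply.
Qed.

(** If X is covered by A and B but neither contains X, take f and g that separate a point of X from
    A and another from B. On a family joining these two points f g is zero, which primality of the
    family forbids. *)
Lemma zirreducible_curves (X : proj F n -> Prop) :
    (exists P, X P) ->
    (forall P P', X P -> X P' -> exists (E : Type) (c : E -> 'rV[F]_n.+1),
       [/\ forall e Q, val Q = <[c e]>%VS -> X Q,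
           exists e, val P = <[c e]>%VS, exists e, val P' = <[c e]>%VS
         & forall f g, (forall e, f.@[c e ord0] * g.@[c e ord0] = 0) ->
           (forall e, f.@[c e ord0] = 0) \/ (forall e, g.@[c e ord0] = 0)]) ->
  zirreducible X.
Proof.
move=> X0 Xc; split=> // A B [S [Sf AS]] [S' [Sf' BS]] XAB.
apply: contrapT => /not_orP[/existsNP[P /not_implyP[XP nAP]]].
move=> /existsNP[P' /not_implyP[XP' nBP']].
have [f /not_implyP[Sf_f nf]] : exists f, ~ (S f -> vanishes_at f P).
  by apply/existsNP; rewrite -AS.
have [g /not_implyP[Sg_g ng]] : exists g, ~ (S' g -> vanishes_at g P').
  by apply/existsNP; rewrite -BS.
have [[d fd] [d' gd]] : is_form f /\ is_form g by split; auto.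
have [E [c [cX [e Ee] [e' Ee'] dom]]] := Xc _ _ XP XP'.
have [i nzi] : exists i, c e ord0 i != 0.
  by have /rV0Pn := proj_vec_neq0 Ee.
(* Where [c e1] is zero there is no projective point; the extra factor ['X_i] makes the product
   vanish there too, and it is removed afterwards because it is nonzero at [e]. *)
have fgX e1 : f.@[c e1 ord0] * g.@[c e1 ord0] * ('X_i : {mpoly F[n.+1]}).@[c e1 ord0] = 0.
  have [->|nz] := eqVneq (c e1) 0.
    by rewrite mevalXU mxE mulr0.
  have [Q EQ] := proj_of_vec nz; have /XAB[AQ|BQ] := cX _ _ EQ.
    by move/AS: AQ => /(_ _ Sf_f) /(vanishes_atE fd EQ) ->; rewrite !mul0r.
  by move/BS: BQ => /(_ _ Sg_g) /(vanishes_atE gd EQ) ->; rewrite mulr0 mul0r.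
have /dom[fg0|X0'] : forall e1, (f * g).@[c e1 ord0] * ('X_i : {mpoly F[n.+1]}).@[c e1 ord0] = 0.
    by move=> e1; rewrite mevalM.
  have /dom[f0|g0] : forall e1, f.@[c e1 ord0] * g.@[c e1 ord0] = 0.
      by move=> e1; rewrite -mevalM.
    by apply: nf; apply/(vanishes_atE fd Ee).
  by apply: ng; apply/(vanishes_atE gd Ee').
by have := X0' e; rewrite mevalXU => /eqP; rewrite (negPf nzi).
Qed.

End ProjectivePoints.

Section PolynomialCurves.
Variables (F : numFieldType) (n : nat).

Lemma poly_curve_prime (c : 'I_n -> {poly F}) (f g : {mpoly F[n]}) :
    (forall a, f.@[fun i => (c i).[a]] * g.@[fun i => (c i).[a]] = 0) ->
  (forall a, f.@[fun i => (c i).[a]] = 0) \/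
  (forall a, g.@[fun i => (c i).[a]] = 0).
Proof.
move=> fg; have : mmap polyC c f * mmap polyC c g = 0.
  by apply: poly_zero_fun => a; rewrite hornerM !mmap_hornerE.
move=> /eqP; rewrite mulf_eq0 => /orP[] /eqP E; [left|right] => a;
by rewrite -mmap_hornerE E horner0.
Qed.

End PolynomialCurves.

(** * The parametrization psi and its equations *)

Section Parametrization.
Variable S : comNzRingType.
Implicit Types (p u : nat -> S).

(* The parameters p 0, ..., p 6 stand for q0, q1, q2, l, t0, t1, t2, where
   q = q0 X^2 + q1 X Y + q2 Y^2 and t = t0 X^2 + 2 t1 X Y + t2 Y^2. *)
Definition psi p (k : nat) : S :=
  let q0 := p 0 in let q1 := p 1 in let q2 := p 2 in let l := p 3 in
  let t0 := p 4 in let t1 := p 5 in let t2 := p 6 in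
  nth 0 [:: t0 * q0; t0 * q1; 2 * l * q0 ^+ 2; (l * q1 + t1) * q0;
    l * (q1 ^+ 2 - 2 * q0 * q2) + t1 * q1; t0 * q2; (l * q1 - t1) * q0;
    2 * l * q0 * q2; (l * q1 + t1) * q2;
    l * (q1 ^+ 2 - 2 * q0 * q2) - t1 * q1; (l * q1 - t1) * q2;
    2 * l * q2 ^+ 2; t2 * q0; t2 * q1; t2 * q2] k.

(** One quarter of disc t - 4 l^2 disc q. *)
Definition hyp p : S :=
  p 5 ^+ 2 - p 4 * p 6 - p 3 ^+ 2 * (p 1 ^+ 2 - 4 * p 0 * p 2).

(* The matrix (2 l q_j q_k | t0 q_j | 2 t1 q_j | t2 q_j) in terms of the
   Pluecker coordinates. *)
Definition scrollmx u (j a : nat) : S :=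
  nth 0 (nth [::] [::
    [:: u 2; u 3 + u 6; u 7; u 0; u 3 - u 6; u 12];
    [:: u 3 + u 6; u 4 + u 9 + 2 * u 7; u 8 + u 10; u 1; u 4 - u 9; u 13];
    [:: u 7; u 8 + u 10; u 11; u 5; u 8 - u 10; u 14]] j) a.

Definition rowpar p (a : nat) : S :=
  nth 0 [:: 2 * p 3 * p 0; 2 * p 3 * p 1; 2 * p 3 * p 2; p 4; 2 * p 5; p 6] a.

Lemma scrollmx_psi p j a : (j < 3)%N ->
  scrollmx (psi p) j a = p j * rowpar p a.
Proof.
case: j => [|[|[|//]]] _; do 6?[case: a => [|a]];
by rewrite /scrollmx /psi /rowpar /= ?nth_nil ?mulr0 //; ring.
Qed.

Lemma scrollmxC u j k : (j < 3)%N -> (k < 3)%N ->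
  scrollmx u j k = scrollmx u k j.
Proof. by case: j => [|[|[|//]]] _; case: k => [|[|[|//]]]. Qed.

Definition minor u (j k a b : nat) :=
  scrollmx u j a * scrollmx u k b - scrollmx u j b * scrollmx u k a.

(** Discriminant of the t block of row j minus that of its l block; on [psi p] these are q_j^2 disc
    t and 4 l^2 q_j^2 disc q. *)
Definition discquad u (j : nat) :=
  scrollmx u j 4 ^+ 2 - 4 * scrollmx u j 3 * scrollmx u j 5
  - (scrollmx u j 1 ^+ 2 - 4 * scrollmx u j 0 * scrollmx u j 2).

Lemma minor_psi p j k a b : (j < 3)%N -> (k < 3)%N -> minor (psi p) j k a b = 0.
Proof. by move=> j3 k3; rewrite /minor !scrollmx_psi //; ring. Qed.

Lemma discquad_psi p j : (j < 3)%N ->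
  discquad (psi p) j = 4 * p j ^+ 2 * hyp p.
Proof.
by move=> j3; rewrite /discquad !scrollmx_psi // /rowpar /hyp /=; ring.
Qed.

End Parametrization.

(** * Compatibility of the parametrization with ring morphisms *)

Section Morphisms.
Variables (S S' : comNzRingType) (phi : {rmorphism S -> S'}).

Lemma rmorph_psi (p : nat -> S) k : phi (psi p k) = psi (phi \o p) k.
Proof.
do 15?[case: k => [|k]]; rewrite /psi /= ?nth_nil ?rmorph0 //;
by rewrite ?(rmorph_nat, rmorph1, rmorphM, rmorphD, rmorphN, rmorphXn).
Qed.

Lemma rmorph_hyp (p : nat -> S) : phi (hyp p) = hyp (phi \o p).
Proof. by rewrite /hyp ?(rmorph_nat, rmorph1, rmorphM, rmorphD, rmorphN, rmorphXn). Qed.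

Lemma rmorph_scrollmx (u : nat -> S) j a :
  phi (scrollmx u j a) = scrollmx (phi \o u) j a.
Proof.
case: j => [|[|[|j]]]; do 6?[case: a => [|a]];
rewrite /scrollmx /= ?nth_nil ?rmorph0 //;
by rewrite ?(rmorph_nat, rmorph1, rmorphM, rmorphD, rmorphN, rmorphXn).
Qed.

Lemma rmorph_minor (u : nat -> S) j k a b :
  phi (minor u j k a b) = minor (phi \o u) j k a b.
Proof. by rewrite /minor rmorphB !rmorphM !rmorph_scrollmx. Qed.

Lemma rmorph_discquad (u : nat -> S) j :
  phi (discquad u j) = discquad (phi \o u) j.
Proof.
rewrite /discquad ?(rmorph_nat, rmorph1, rmorphM, rmorphD, rmorphN, rmorphXn).
by rewrite !rmorph_scrollmx.
Qed.

End Morphisms.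

(** * Recovering the parameters from the quadrics *)

Section Recovery.
Variable F : numFieldType.
Implicit Types (p u : nat -> F).

(** A linear left inverse of [scrollmx] on the 15 coordinates; it divides by 2. *)
Definition unscroll (M : nat -> nat -> F) (k : nat) : F :=
  nth 0 [:: M 0 3; M 1 3; M 0 0; 2^-1 * (M 0 1 + M 0 4);
    2^-1 * (M 1 1 - 2 * M 0 2 + M 1 4); M 2 3; 2^-1 * (M 0 1 - M 0 4);
    M 0 2; 2^-1 * (M 1 2 + M 2 4); 2^-1 * (M 1 1 - 2 * M 0 2 - M 1 4);
    2^-1 * (M 1 2 - M 2 4); M 2 2; M 0 5; M 1 5; M 2 5] k.

Lemma scrollmxK u k : (k < 15)%N -> unscroll (scrollmx u) k = u k.
Proof.
have nz2 : (2 : F) != 0 by rewrite pnatr_eq0.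
by do 15?[case: k => [|k]]; rewrite /unscroll /scrollmx //= => _; field.
Qed.

Lemma scrollmx_inj u u' :
    (forall j a, (j < 3)%N -> (a < 6)%N -> scrollmx u j a = scrollmx u' j a) ->
  forall k, (k < 15)%N -> u k = u' k.
Proof.
by move=> E k k15; rewrite -scrollmxK // -[RHS]scrollmxK // /unscroll !E.
Qed.

(* A vector satisfying the quadrics has a scroll matrix of rank one, whose
   symmetric block forces the row factor to be (2 l q0, 2 l q1, 2 l q2, ...). *)
Lemma quadrics_psi u :
    (forall j k a b, (j < 3)%N -> (k < 3)%N -> (a < 6)%N -> (b < 6)%N ->
      minor u j k a b = 0) ->
    (forall j, (j < 3)%N -> discquad u j = 0) ->
    (exists2 k, (k < 15)%N & u k != 0) ->
  exists p, hyp p = 0 /\ forall k, (k < 15)%N -> u k = psi p k.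
Proof.
move=> min0 disc0 [k0 k15 nzu]; have nz2 : (2 : F) != 0 by rewrite pnatr_eq0.
have [j [a [j3 a6 nzja]]] : exists j a,
    [/\ (j < 3)%N, (a < 6)%N & scrollmx u j a != 0].
  apply: contrapT => H; case/eqP: nzu; have -> : u k0 = (fun=> 0) k0; last by [].
  apply: scrollmx_inj k15 => j a j3 a6; apply/eqP/negPn/negP => nz.
  by apply: H; exists j, a; split=> //; apply: contra nz => /eqP ->;
    move: j3 a6; case: j => [|[|[|//]]] _; do 6?[case: a => [|a]];
    rewrite /scrollmx //= ?(addr0, subrr, mulr0).
pose N := scrollmx u; rewrite -/N in nzja; pose r b := N j b / N j a.
have Nqr k b : (k < 3)%N -> (b < 6)%N -> N k b = N k a * r b.
  move=> k3 b6; have /eqP := min0 j k a b j3 k3 a6 b6; rewrite subr_eq0 => /eqP E.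
  by apply: (mulfI nzja); rewrite E /r /N; field.
(* Symmetry, N k j = N j k, makes the first three entries of r proportional to column a; the ratio r
   j / N j a plays the part of 2 l. *)
pose l := r j / N j a / 2.
have rl k : (k < 3)%N -> r k = 2 * l * N k a.
  move=> k3; have lt6 i : (i < 3)%N -> (i < 6)%N by move/ltn_trans; apply.
  have := Nqr j k j3 (lt6 k k3).
  rewrite /N scrollmxC // -/N (Nqr k j k3 (lt6 j j3)) => E.
  by apply: (mulfI nzja); rewrite -E /l; field; rewrite nzja.
pose p k := nth 0 [:: N 0 a; N 1 a; N 2 a; l; r 3; r 4 / 2; r 5] k.
have Np k b : (k < 3)%N -> (b < 6)%N -> N k b = scrollmx (psi p) k b.
  move=> k3 b6; rewrite scrollmx_psi // Nqr //; congr (_ * _).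
    by case: k k3 => [|[|[|]]].
  do 6?[case: b b6 => [|b] b6] => //; rewrite /rowpar /p /=
    ?(rl 0 isT, rl 1 isT, rl 2 isT) //; by field.
exists p; split; last exact: scrollmx_inj.
have := disc0 j j3; rewrite /discquad -/N !Np // -/(discquad _ j) discquad_psi //.
have -> : p j = N j a by case: (j) j3 => [|[|[|]]].
by move/eqP; rewrite !mulf_eq0 (negPf nzja) pnatr_eq0 /= => /eqP.
Qed.

End Recovery.

(** * Curves T^2 = delta *)

Section DoubleCover.
Variables (F : numClosedFieldType) (delta : {poly F}).
Implicit Types (G H : {poly {poly F}}).

Definition on_cover (x : F * F) := x.2 ^+ 2 = delta.[x.1].

(** The inner variable is the parameter e, the outer one the square root T. *)
Definition eval2 G (x : F * F) : F := G.[x.2%:P].[x.1].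

Lemma on_coverN e t : on_cover (e, t) -> on_cover (e, - t).
Proof. by rewrite /on_cover /= sqrrN. Qed.

Lemma on_cover_sqrtC e : on_cover (e, sqrtC delta.[e]).
Proof. by rewrite /on_cover /= sqrtCK. Qed.

Lemma cover_modulus_monic : ('X^2 - delta%:P : {poly {poly F}}) \is monic.
Proof.
apply/monicP; rewrite lead_coefDl ?lead_coefXn // size_polyN size_polyXn.
exact: leq_ltn_trans (size_polyC_leq1 _) _.
Qed.

Lemma cover_reduce G : exists a b H,
  G = H * ('X^2 - delta%:P) + (a%:P + b *: 'X).
Proof.
have mon := cover_modulus_monic; set m := _ - _ in mon *.
have sz_m : size m = 3%N.
  by rewrite /m size_polyDl size_polyXn // size_polyN ltnS
     (leq_trans (size_polyC_leq1 _)).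
have := Pdiv.RingMonic.rdivp_eq mon G; set R := Pdiv.Ring.rmodp _ _ => ->.
have szR : (size R <= 2)%N.
  by rewrite -ltnS -sz_m Pdiv.Ring.ltn_rmodpN0 // monic_neq0.
exists R`_0, R`_1, (Pdiv.Ring.rdivp G m); congr (_ + _).
apply/polyP => i; rewrite coefD coefC coefZ coefX.
case: i => [|[|i]]; rewrite /= ?mulr0 ?addr0 ?mulr1 ?add0r //.
by rewrite nth_default ?(leq_trans szR).
Qed.

Lemma cover_reduceE G a b H x :
  G = H * ('X^2 - delta%:P) + (a%:P + b *: 'X) -> on_cover x ->
  eval2 G x = a.[x.1] + b.[x.1] * x.2.
Proof.
move=> -> E; rewrite /eval2 !(hornerD, hornerM, hornerN, hornerXn, hornerZ,
  hornerC, hornerX, horner_exp).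
by rewrite -expr2 E subrr mulr0 add0r.
Qed.

(** At the two points over e the remainder a + b T takes the values a(e) + b(e) s and a(e) - b(e) s,
    so a and b delta vanish identically. *)
Lemma cover_divides G : delta != 0 ->
  (forall x, on_cover x -> eval2 G x = 0) ->
  exists H, G = H * ('X^2 - delta%:P).
Proof.
move=> nzd G0; have [a [b [H EG]]] := cover_reduce G.
have ab0 e : a.[e] = 0 /\ b.[e] * sqrtC delta.[e] = 0.
  have ont := on_cover_sqrtC e; have onN := on_coverN ont.
  have /= Ep := cover_reduceE EG ont; have /= Em := cover_reduceE EG onN.
  rewrite G0 // in Ep; rewrite G0 // in Em.
  move: Ep Em; set s := sqrtC _; move=> Ep Em.
  have a0 : a.[e] = 0.
    apply: (mulfI (_ : (2 : F) != 0)); first by rewrite pnatr_eq0.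
    have -> : 2 * a.[e] = (a.[e] + b.[e] * s) + (a.[e] + b.[e] * - s) by ring.
    by rewrite -Ep -Em addr0 mulr0.
  by split=> //; rewrite Ep a0 add0r.
have a0 : a = 0 by apply: poly_zero_fun => e; case: (ab0 e).
have /eqP : b * delta = 0.
  apply: poly_zero_fun => e; rewrite hornerM; case: (ab0 e) => _.
  by rewrite -{2}(sqrtCK delta.[e]) expr2 mulrA => ->; rewrite mul0r.
rewrite mulf_eq0 (negPf nzd) orbF => /eqP b0.
by exists H; rewrite EG a0 b0 scale0r polyC0 !addr0.
Qed.

(* The norm a^2 - b^2 delta of a + b T is nonzero by parity of degrees. *)
Lemma cover_prime G H : ~~ odd (size delta) -> delta != 0 ->
  (forall x, on_cover x -> eval2 G x * eval2 H x = 0) ->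
  (forall x, on_cover x -> eval2 G x = 0) \/
  (forall x, on_cover x -> eval2 H x = 0).
Proof.
move=> odd_d nzd GH0.
have [a [b [G' EG]]] := cover_reduce G; have [c [d [H' EH]]] := cover_reduce H.
have norm0 a' b' : a' ^+ 2 - b' ^+ 2 * delta = 0 -> a' = 0 /\ b' = 0.
  move=> /eqP; rewrite subr_eq0 => /eqP E.
  have [b0|nzb] := eqVneq b' 0.
    by move: E; rewrite b0 expr0n mul0r => /eqP; rewrite sqrf_eq0 => /eqP a0; split.
  have := congr1 (fun p : {poly F} => odd (size p)) E.
  have [a0|nza] := eqVneq a' 0.
    move: E; rewrite a0 expr0n => /esym /eqP; rewrite mulf_eq0 expf_eq0 /=.
    by rewrite (negPf nzb) (negPf nzd).
  rewrite size_mul ?expf_neq0 // !expr2 !size_mul //.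
  move: nza nzb nzd odd_d; rewrite -!size_poly_gt0.
  case: (size a') (size b') (size delta) => [|m] [|i] [|k] //= _ _ _ /negPn oddk.
    by rewrite !addnS addSn /= !oddD oddk; case: (odd m); case: (odd i).
  by rewrite mulf_neq0.
(* At each e the product of the two norms is the product of the values of G H at the two points over
   e. *)
have : (a ^+ 2 - b ^+ 2 * delta) * (c ^+ 2 - d ^+ 2 * delta) = 0.
  apply: poly_zero_fun => e; have ont := on_cover_sqrtC e.
  have onN := on_coverN ont.
  have := GH0 _ ont; have := GH0 _ onN.
  rewrite !(cover_reduceE EG) // !(cover_reduceE EH) //=.
  have := sqrtCK delta.[e]; set s := sqrtC _ => Es E1 E2.
  rewrite !hornerE -Es.
  transitivity ((a.[e] + b.[e] * s) * (c.[e] + d.[e] * s) *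
     ((a.[e] + b.[e] * - s) * (c.[e] + d.[e] * - s))); first by ring.
  by rewrite E2 mul0r.
move/eqP; rewrite mulf_eq0 => /orP[] /eqP /norm0[z1 z2]; [left|right] => x onx.
  by rewrite (cover_reduceE EG onx) z1 z2 !horner0 mul0r addr0.
by rewrite (cover_reduceE EH onx) z1 z2 !horner0 mul0r addr0.
Qed.

End DoubleCover.

(** * The image of psi is closed and irreducible *)

Section Variety.
Variable F : numClosedFieldType.
Implicit Types (p w : nat -> F) (P : proj F 14) (f g : {mpoly F[15]}).

Definition psiv p : 'rV[F]_15 := \row_k psi p k.

(** A point is spanned by a nonzero vector, so [psiv p] is nonzero here; this encodes q <> 0 and (l,
    t) <> 0. *)
Definition secvar P : Prop := exists p, hyp p = 0 /\ val P = <[psiv p]>%VS.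

Definition Xs (k : nat) : {mpoly F[15]} := 'X_(inord k).

Lemma Xs_homog k : Xs k \is 1.-homog.
Proof. by rewrite dhomogX /= mdeg1. Qed.

Lemma scrollmx_homog j a : scrollmx Xs j a \is 1.-homog.
Proof.
case: j => [|[|[|j]]]; do 6?[case: a => [|a]]; rewrite /scrollmx /= ?nth_nil;
by rewrite ?mulr_natl ?(rpredB, rpredD, rpredMn, rpred0, Xs_homog).
Qed.

Lemma minor_homog j k a b : minor Xs j k a b \is 2.-homog.
Proof. by rewrite /minor rpredB // (@dhomogM _ _ _ 1 _ 1) ?scrollmx_homog. Qed.

Lemma discquad_homog j : discquad Xs j \is 2.-homog.
Proof.
rewrite /discquad !expr2 -!mulrA !mulr_natl.
by rewrite !(rpredB, rpredMn) // (@dhomogM _ _ _ 1 _ 1) ?scrollmx_homog.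
Qed.

Lemma mmap_Xs (S : comNzRingType) (phi : {rmorphism F -> S}) (c : 'I_15 -> S) k :
  mmap phi c (Xs k) = c (inord k).
Proof. by rewrite /Xs mmapX mmap1U. Qed.

Lemma meval_minor (v : 'I_15 -> F) j k a b :
  (minor Xs j k a b).@[v] = minor (fun i => v (inord i)) j k a b.
Proof. by rewrite rmorph_minor; congr minor; apply: funext => i /=; rewrite mevalXU. Qed.

Lemma meval_discquad (v : 'I_15 -> F) j :
  (discquad Xs j).@[v] = discquad (fun i => v (inord i)) j.
Proof. by rewrite rmorph_discquad; congr discquad; apply: funext => i /=; rewrite mevalXU. Qed.

Lemma minor_form j k a b : (j < 3)%N -> (k < 3)%N ->
  form_on secvar (minor Xs j k a b).
Proof.
move=> j3 k3; split=> [|P [p [hp EP]]]; first by exists 2; apply: minor_homog.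
apply/(vanishes_atE (minor_homog _ _ _ _) EP); rewrite meval_minor.
rewrite -[RHS](minor_psi p a b j3 k3) /minor /scrollmx.
by rewrite !mxE !inordK.
Qed.

Lemma discquad_form j : (j < 3)%N -> form_on secvar (discquad Xs j).
Proof.
move=> j3; split=> [|P [p [hp EP]]]; first by exists 2; apply: discquad_homog.
apply/(vanishes_atE (discquad_homog _) EP); rewrite meval_discquad.
transitivity (discquad (psi p) j); first by rewrite /discquad /scrollmx !mxE !inordK.
by rewrite discquad_psi // hp mulr0.
Qed.

(** By [quadrics_psi] the minors and the [discquad] quadrics already cut out the image; all forms of
    the ideal are taken as equations, which makes one inclusion immediate. *)
Lemma secvar_closed : zclosed secvar.
Proof.
exists (form_on secvar); split=> [f []//|P]; split=> [XP f [_ f0]|f0].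
  exact: f0.
have [u EP] := proj_vecP P; have nzu := proj_vec_neq0 EP.
have [||| p [hp Ep]] := @quadrics_psi F (fun i => u ord0 (inord i)).
- move=> j k a b j3 k3 _ _; rewrite -meval_minor.
  by apply/(vanishes_atE (minor_homog _ _ _ _) EP)/f0/minor_form.
- move=> j j3; rewrite -meval_discquad.
  by apply/(vanishes_atE (discquad_homog _) EP)/f0/discquad_form.
- by have /rV0Pn[i nz] := nzu; exists (i : nat); rewrite ?ltn_ord ?inord_val.
exists p; split=> //; rewrite EP; congr <[_]>%VS; apply/rowP => i.
by rewrite mxE -Ep ?ltn_ord // inord_val.
Qed.

(* The perturbation in degrees 3 and 4 makes the discriminant of the double
   cover T^2 = delta of the parameter line a polynomial of degree 7. *)
Definition jet p w (s : F) (i : nat) : {poly F} :=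
  ((p i)%:P + w i *: 'X +
  (if i == 4%N then 'X^3 - s *: 'X^2
   else if i == 6%N then 'X^4 - s *: 'X^3 else 0))%R.

(** The value that [hyp] imposes on t1^2 along the jet. *)
Definition jet_disc p w s : {poly F} :=
  jet p w s 4 * jet p w s 6 +
  jet p w s 3 ^+ 2 * (jet p w s 1 ^+ 2 - 4 * jet p w s 0 * jet p w s 2).

(** The product t0 t2 has degree 3 + 4 and the other term at most 4, so the degree is 7, an odd
    number, whatever p, w and s are. *)
Lemma size_jet_disc p w s : size (jet_disc p w s) = 8%N.
Proof.
have lin i : (size ((p i)%:P + w i *: 'X : {poly F})%R <= 2)%N.
  apply: leq_trans (size_polyD _ _) _; rewrite geq_max.
  rewrite (leq_trans (size_polyC_leq1 _)) //=.
  by apply: leq_trans (size_scale_leq _ _) _; rewrite size_polyX.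
have sz k : size ('X^(k.+1) - s *: 'X^k : {poly F}) = k.+2%N.
  rewrite size_polyDl size_polyXn // size_polyN ltnS.
  by apply: leq_trans (size_scale_leq _ _) _; rewrite size_polyXn.
have s4 : size (jet p w s 4) = 4%N.
  by rewrite /jet /= addrC size_polyDl sz // (leq_ltn_trans (lin _)).
have s6 : size (jet p w s 6) = 5%N.
  by rewrite /jet /= addrC size_polyDl sz // (leq_ltn_trans (lin _)).
have s2 i : i \in [:: 0; 1; 2; 3]%N -> (size (jet p w s i) <= 2)%N.
  rewrite !inE /jet => /or4P[] /eqP -> /=; rewrite addr0; exact: lin.
have szM (a b : {poly F}) m k : (size a <= m.+1)%N -> (size b <= k.+1)%N ->
    (size (a * b)%R <= (m + k).+1)%N.
  move=> am bk; apply: leq_trans (size_polyMleq _ _) _.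
  by rewrite -subn1 leq_subLR (leq_trans (leq_add am bk)) // addSn addnS add1n.
have sM : size (jet p w s 4 * jet p w s 6)%R = 8%N.
  by rewrite size_mul -?size_poly_gt0 ?s4 ?s6.
rewrite /jet_disc size_polyDl sM // ltnS; apply: (@leq_trans 5) => //; apply: (@szM _ _ 2 2).
  by rewrite expr2; apply: (@szM _ _ 1 1); apply: s2.
apply: leq_trans (size_polyD _ _) _; rewrite geq_max size_polyN.
rewrite expr2 (@szM _ _ 1 1) ?s2 //=.
rewrite -mulrA (_ : 4 = 4%:P :> {poly F}); last by rewrite rmorph_nat.
by apply: (@szM _ _ 0 2); rewrite ?size_polyC_leq1 // (@szM _ _ 1 1) ?s2.
Qed.

(** The coordinate t1 becomes the square root T; the other parameters follow the jet. *)
Definition jet_cover p w s (i : nat) : {poly {poly F}} :=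
  if i == 5%N then 'X else (jet p w s i)%:P.

Definition cover_par p w s (x : F * F) (i : nat) : F :=
  if i == 5%N then x.2 else (jet p w s i).[x.1].

Definition pullback p w s f : {poly {poly F}} :=
  mmap (polyC \o polyC) (fun k : 'I_15 => psi (jet_cover p w s) k) f.

Lemma eval2_pullback p w s f x :
  eval2 (pullback p w s f) x = f.@[fun k => psi (cover_par p w s x) k].
Proof.
rewrite /eval2 -[LHS]/((horner_eval x.1 \o horner_eval x.2%:P) _) rmorph_mmap.
apply: eq_mmap => [a|k] /=; first by rewrite /horner_eval !hornerC.
rewrite -[LHS]/((horner_eval x.1 \o horner_eval x.2%:P) _) rmorph_psi.
congr psi; apply: funext => i; rewrite /jet_cover /cover_par /= /horner_eval.
by case: (i == 5%N); rewrite ?hornerX hornerC.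
Qed.

Lemma hyp_cover_par p w s x : on_cover (jet_disc p w s) x ->
  hyp (cover_par p w s x) = 0.
Proof.
rewrite /on_cover /jet_disc /hyp /cover_par /= => ->.
rewrite -polyC_natr !(hornerD, hornerM, hornerN, hornerC); ring.
Qed.

Lemma cover_par0 p w s : cover_par p w s (0, p 5) =1 p.
Proof.
move=> i; rewrite /cover_par /=; case: eqP => [-> //|_]; rewrite /jet.
by case: (i == 4%N); case: (i == 6%N); rewrite !hornerE ?hornerXn //=; ring.
Qed.

(** For s = 1 the perturbation e^3 - e^2, e^4 - e^3 vanishes at e = 1 as well as at e = 0, so the
    curve joins p to p'. *)
Lemma cover_par1 p p' :
  cover_par p (fun i => p' i - p i) 1 (1, p' 5) =1 p'.
Proof.
move=> i; rewrite /cover_par /=; case: eqP => [-> //|_]; rewrite /jet.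
by case: (i == 4%N); case: (i == 6%N); rewrite !hornerE ?hornerXn //=; ring.
Qed.

Lemma on_jet_disc p w s x : hyp (cover_par p w s x) = 0 ->
  on_cover (jet_disc p w s) x.
Proof.
move=> h0; rewrite /on_cover -[LHS]subr0 -h0 /jet_disc /hyp /cover_par /=.
by rewrite -polyC_natr !(hornerD, hornerM, hornerN, hornerC); ring.
Qed.

Lemma secvar_witness : exists p, [/\ hyp p = 0, psi p 2 != 0 & psiv p != 0].
Proof.
(* q = X^2 + X Y, l = 1, t = 2 X Y: both disc t and 4 l^2 disc q equal 4, and coordinate 2 is 2 l
   q0^2 = 2. *)
pose p i : F := (i \in [:: 0; 1; 3; 5]%N)%:R.
have nz : psi p 2 != 0 by rewrite /psi /p /= expr1n !mulr1 pnatr_eq0.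
exists p; split=> //; first by rewrite /hyp /p /=; ring.
by apply: contra nz => /eqP/rowP/(_ (inord 2)); rewrite !mxE inordK // => ->.
Qed.

(** Two parameters p and p' lie over e = 0 and e = 1 on the double cover T^2 = [jet_disc], where
    [cover_prime] applies. *)
Lemma secvar_irreducible : zirreducible secvar.
Proof.
apply: zirreducible_curves.
  have [p [hp _ nz]] := secvar_witness.
  by have [P EP] := proj_of_vec nz; exists P; exists p.
move=> P P' [p [hp EP]] [p' [hp' EP']].
pose w i := p' i - p i; pose D := jet_disc p w 1.
exists {x : F * F | on_cover D x}, (fun x => psiv (cover_par p w 1 (sval x))).
have on0 : on_cover D (0, p 5).
  by apply: on_jet_disc; rewrite (_ : cover_par _ _ _ _ = p) //; apply/funext/cover_par0.
have on1 : on_cover D (1, p' 5).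
  by apply: on_jet_disc; rewrite (_ : cover_par _ _ _ _ = p') //; apply/funext/cover_par1.
split.
- move=> x Q EQ; exists (cover_par p w 1 (sval x)); split=> //.
  exact/hyp_cover_par/(svalP x).
- exists (exist _ _ on0); rewrite EP; congr <[psiv _]>%VS.
  by apply/esym/funext/cover_par0.
- exists (exist _ _ on1); rewrite EP'; congr <[psiv _]>%VS.
  by apply/esym/funext/cover_par1.
move=> f g fg0; have Ev h x : h.@[psiv (cover_par p w 1 x) ord0] = eval2 (pullback p w 1 h) x.
  by rewrite eval2_pullback; apply: meval_eq => k; rewrite mxE.
have nzD : D != 0 by rewrite -size_poly_gt0 size_jet_disc.
have odd_D : ~~ odd (size D) by rewrite size_jet_disc.
have [|f0|g0] := cover_prime (G := pullback p w 1 f) (H := pullback p w 1 g) odd_D nzD.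
- by move=> x onx; rewrite -!Ev; apply: (fg0 (exist _ x onx)).
- by left=> -[x onx]; rewrite Ev f0.
by right=> -[x onx]; rewrite Ev g0.
Qed.

End Variety.

(** * Tangent spaces *)

Lemma coef1M (R : comNzRingType) (a b : {poly R}) :
  (a * b)`_1 = a`_0 * b`_1 + a`_1 * b`_0.
Proof. by rewrite coefM big_ord_recr big_ord1. Qed.

Lemma dhomog_mderiv n (R : comNzRingType) d (f : {mpoly R[n]}) i :
  f \is d.-homog -> f^`M(i) \is d.-1.-homog.
Proof.
move=> /dhomogP fd; apply/dhomogP => m; rewrite mcoeff_msupp mcoeff_mderiv => nz.
have /fd <- : (m + U_(i))%MM \in msupp f.
  by rewrite mcoeff_msupp; apply: contra nz => /eqP ->; rewrite mul0rn.
by rewrite /= mdegD mdeg1 addn1.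
Qed.

Section Tangent.
Variable F : numClosedFieldType.
Implicit Types (p w : nat -> F) (P : proj F 14) (f g : {mpoly F[15]}).

Definition dhyp p w : F :=
  2 * p 5 * w 5 - p 4 * w 6 - w 4 * p 6
  - 2 * p 3 * w 3 * (p 1 ^+ 2 - 4 * p 0 * p 2)
  - p 3 ^+ 2 * (2 * p 1 * w 1 - 4 * (p 0 * w 2 + w 0 * p 2)).

Definition drowpar p w (a : nat) : F :=
  nth 0 [:: 2 * (p 3 * w 0 + w 3 * p 0); 2 * (p 3 * w 1 + w 3 * p 1);
    2 * (p 3 * w 2 + w 3 * p 2); w 4; 2 * w 5; w 6] a.

(** The differential of [psi]: Leibniz rule on the rank one matrix, carried back by [unscroll], so
    that kernels and images can be studied on matrices. *)
Definition dpsi p w : nat -> F :=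
  unscroll (fun j a => w j * rowpar p a + p j * drowpar p w a).

Definition has_jet (b : nat -> {poly F}) p w :=
  forall i, (b i)`_0 = p i /\ (b i)`_1 = w i.

(** The matrix is linear in u with integer coefficients. *)
Lemma coef_scrollmx (u : nat -> {poly F}) j a i :
  (scrollmx u j a)`_i = scrollmx (fun k => (u k)`_i) j a.
Proof.
case: j => [|[|[|j]]]; do 6?[case: a => [|a]];
rewrite /scrollmx /= ?nth_nil ?coef0 //;
by rewrite ?mulr_natl ?(coefMn, coefD, coefN).
Qed.

Lemma coef0_psi b p w k : has_jet b p w -> (psi b k)`_0 = psi p k.
Proof.
move=> bj; rewrite -horner_coef0 -[LHS]/(horner_eval 0 _) rmorph_psi.
congr psi; apply: funext => i /=; rewrite /horner_eval horner_coef0.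
by case: (bj i).
Qed.

Lemma coef0_hyp b p w : has_jet b p w -> (hyp b)`_0 = hyp p.
Proof.
move=> bj; rewrite -horner_coef0 -[LHS]/(horner_eval 0 _) rmorph_hyp.
congr hyp; apply: funext => i /=; rewrite /horner_eval horner_coef0.
by case: (bj i).
Qed.

Lemma coef1_hyp b p w : has_jet b p w -> (hyp b)`_1 = dhyp p w.
Proof.
move=> bj; have E0 i : (b i)`_0 = p i by case: (bj i).
have E1 i : (b i)`_1 = w i by case: (bj i).
rewrite /hyp -polyC_natr !expr2 !(coefB, coef1M, coefN, coef0M, coefD, coefC, E0, E1) /=.
by rewrite /dhyp; ring.
Qed.

Lemma coef1_rowpar b p w a : has_jet b p w -> (rowpar b a)`_1 = drowpar p w a.
Proof.
move=> bj; have E0 i : (b i)`_0 = p i by case: (bj i).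
have E1 i : (b i)`_1 = w i by case: (bj i).
do 6?[case: a => [|a]]; rewrite /rowpar /drowpar /= ?nth_nil ?coef0 //;
by rewrite -?polyC_natr !(coef1M, coef0M, coefC, E0, E1) /=; ring.
Qed.

Lemma coef0_rowpar b p w a : has_jet b p w -> (rowpar b a)`_0 = rowpar p a.
Proof.
move=> bj; have E0 i : (b i)`_0 = p i by case: (bj i).
do 6?[case: a => [|a]]; rewrite /rowpar /= ?nth_nil ?coef0 //;
by rewrite -?polyC_natr !(coef1M, coef0M, coefC, E0) /=; ring.
Qed.

Lemma coef1_rank1 b p w j a : has_jet b p w ->
  (b j * rowpar b a)`_1 = w j * rowpar p a + p j * drowpar p w a.
Proof.
move=> bj; rewrite coef1M (coef0_rowpar _ bj) (coef1_rowpar _ bj).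
by have [-> ->] := bj j; rewrite addrC.
Qed.

Lemma coef1_psi b p w k : has_jet b p w -> (k < 15)%N ->
  (psi b k)`_1 = dpsi p w k.
Proof.
move=> bj k15; rewrite -[LHS](scrollmxK (fun k => (psi b k)`_1)) // /dpsi.
by rewrite /unscroll -!coef_scrollmx !scrollmx_psi // !(coef1_rank1 _ _ bj).
Qed.

Lemma scrollmx_dpsi p w j a : (j < 3)%N -> (a < 6)%N ->
  scrollmx (dpsi p w) j a = w j * rowpar p a + p j * drowpar p w a.
Proof.
move=> j3 a6; pose b i : {poly F} := (p i)%:P + w i *: 'X.
have bj : has_jet b p w.
  move=> i; rewrite /b !coefD !coefC !coefZ !coefX /=.
  by rewrite mulr0 mulr1 addr0 add0r.
have -> : scrollmx (dpsi p w) j a = scrollmx (fun k => (psi b k)`_1) j a.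
  by rewrite /scrollmx !(coef1_psi bj).
by rewrite -coef_scrollmx scrollmx_psi // (coef1_rank1 _ _ bj).
Qed.

Definition dpsiv p w : 'rV[F]_15 := \row_k dpsi p w k.

Lemma has_jet_jet p w : has_jet (jet p w 0) p w.
Proof.
move=> i; rewrite /jet; case: (i == 4%N); case: (i == 6%N);
by rewrite !(coefD, coefB, coefN, coefC, coefZ, coefX, coefXn, coef0) /=
  ?(mulr0, mulr1, addr0, add0r, mul0r, subr0, oppr0).
Qed.

(* The pullback of f along the jet is a multiple of T^2 - delta; putting
   T = t1 + w5 e turns T^2 - delta into hyp of the jet, which is O(e^2). *)
Lemma tangent_dpsi p w P : hyp p = 0 -> val P = <[psiv p]>%VS ->
  dhyp p w = 0 -> tangent_vector (@secvar F) P (dpsiv p w).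
Proof.
move=> hp EP dw f [[d fd] f0] u; rewrite EP => /vlineP[a ->].
have nzp := proj_vec_neq0 EP.
suff tan1 : \sum_(i < 15) (f^`M(i)).@[psiv p ord0] * dpsiv p w ord0 i = 0.
  transitivity (a ^+ d.-1 * \sum_(i < 15) (f^`M(i)).@[psiv p ord0] * dpsiv p w ord0 i).
    rewrite mulr_sumr; apply: eq_bigr => i _; rewrite mulrA; congr (_ * _).
    rewrite -(meval_homogZ _ _ (dhomog_mderiv i fd)).
    by apply: meval_eq => j; rewrite mxE.
  by rewrite tan1 mulr0.
have nzD : jet_disc p w 0 != 0 by rewrite -size_poly_gt0 size_jet_disc.
have [x onx|H EH] := cover_divides (G := pullback p w 0 f) nzD.
  rewrite eval2_pullback; have hx := hyp_cover_par onx.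
  (* Where [psiv] is zero there is no point of [secvar], but f still vanishes at the zero vector,
     since that vector belongs to [val P]. *)
  have [z|nz] := eqVneq (psiv (cover_par p w 0 x)) 0; last first.
    have [Q EQ] := proj_of_vec nz.
    have /(vanishes_atE fd EQ) : vanishes_at f Q by apply: f0; exists (cover_par p w 0 x).
    by move=> E; rewrite -[RHS]E; apply: meval_eq => k; rewrite mxE.
  have : vanishes_at f P by apply: f0; exists p.
  move/(_ 0 (mem0v _)) => E; rewrite -[RHS]E; apply: meval_eq => k.
  by have /rowP/(_ k) := z; rewrite !mxE => ->.
pose b i : {poly F} := if i == 5%N then (p 5)%:P + w 5 *: 'X else jet p w 0 i.
have bj : has_jet b p w.
  move=> i; rewrite /b; case: eqP => [->|_]; last exact: has_jet_jet.
  rewrite !coefD !coefC !coefZ !coefX /=.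
  by rewrite mulr0 mulr1 addr0 add0r.
have Ef : mmap polyC (fun k : 'I_15 => psi b k) f = H.[b 5] * hyp b.
  transitivity (pullback p w 0 f).[b 5].
    rewrite -[RHS]/(horner_eval _ _) rmorph_mmap.
    apply: eq_mmap => [c|k] /=; first by rewrite /horner_eval hornerC.
    rewrite rmorph_psi; congr psi; apply: funext => i.
    rewrite /jet_cover /b /= /horner_eval; case: (i == 5%N) => /=.
      by rewrite hornerX.
    by rewrite hornerC.
  rewrite EH hornerM hornerD hornerN hornerC hornerXn /jet_disc /hyp /b /=.
  by congr (_ * _); ring.
have := deriv_mmap0 (fun k : 'I_15 => psi b k) f.
rewrite Ef coef1M (coef0_hyp bj) hp (coef1_hyp bj) dw mulr0 mulr0 add0r => E.
rewrite [RHS]E; apply: eq_bigr => i _; rewrite !mxE (coef1_psi bj) ?ltn_ord //.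
by congr (_ * _); apply: meval_eq => j; rewrite mxE (coef0_psi _ bj).
Qed.

End Tangent.

(** * Upper bound on the tangent spaces *)

Section TangentUpper.
Variable F : numClosedFieldType.
Implicit Types (p w : nat -> F) (P : proj F 14) (f g : {mpoly F[15]}).

(** By the chain rule a tangent vector kills the first order term of f along any curve with 1-jet
    (u, v); this allows the quadrics to be differentiated without computing partial derivatives. *)
Lemma tangent_coef1 P u v f (c : 'I_15 -> {poly F}) :
  val P = <[u]>%VS -> tangent_vector (@secvar F) P v -> form_on (@secvar F) f ->
  (forall k, (c k)`_0 = u ord0 k) -> (forall k, (c k)`_1 = v ord0 k) ->
  (mmap polyC c f)`_1 = 0.
Proof.
move=> EP tv ff c0 c1; rewrite deriv_mmap0 -[RHS](tv f ff u).
  by apply: eq_bigr => i _; rewrite c1; congr (_ * _); apply: meval_eq.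
by rewrite EP memv_line.
Qed.

Lemma mmap_minor (S : comNzRingType) (phi : {rmorphism F -> S}) (c : nat -> S) j k a b :
  mmap phi (fun i : 'I_15 => c i) (minor (@Xs F) j k a b) = minor c j k a b.
Proof.
rewrite rmorph_minor /minor /scrollmx /=.
by rewrite !mmap_Xs !inordK.
Qed.

Lemma mmap_discquad (S : comNzRingType) (phi : {rmorphism F -> S}) (c : nat -> S) j :
  mmap phi (fun i : 'I_15 => c i) (discquad (@Xs F) j) = discquad c j.
Proof.
rewrite rmorph_discquad /discquad /scrollmx /=.
by rewrite !mmap_Xs !inordK.
Qed.

Lemma psiv_neq0 p : psiv p != 0 ->
  exists j a, [/\ (j < 3)%N, (a < 6)%N, p j != 0 & rowpar p a != 0].
Proof.
move=> nz; apply: contrapT => H; case/eqP: nz; apply/rowP => k; rewrite !mxE.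
apply: (@scrollmx_inj F (psi p) (fun=> 0)) (ltn_ord k) => j a j3 a6; rewrite scrollmx_psi //.
have -> : scrollmx (fun=> 0 : F) j a = 0.
  case: j j3 => [|[|[|//]]] _; do 6?[case: a a6 => [|a] a6] => //;
    by rewrite /scrollmx /= ?mulr0 ?subr0 ?addr0.
apply/eqP; apply: contrapT => /negP; rewrite mulf_eq0 negb_or => /andP[nzj nza].
by apply: H; exists j, a.
Qed.

(** The linearized minors write the matrix of v as dq r + q dr, symmetry of its block expresses the
    first entries of dr through dq and a single number dl, and the linearized [discquad] gives
    [dhyp p w = 0]. *)
Lemma tangent_lift p P v : hyp p = 0 -> val P = <[psiv p]>%VS ->
  tangent_vector (@secvar F) P v -> exists w, dhyp p w = 0 /\ v = dpsiv p w.
Proof.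
move=> hp EP tv; have [j [a [j3 a6 nzj nza]]] := psiv_neq0 (proj_vec_neq0 EP).
have nz2 : (2 : F) != 0 by rewrite pnatr_eq0.
pose nv k := v ord0 (inord k); pose N := scrollmx nv; pose r := rowpar p.
pose cv k : {poly F} := (psi p k)%:P + nv k *: 'X.
have cv0 k : (cv k)`_0 = psi p k.
  by rewrite /cv coefD coefC coefZ coefX mulr0 addr0.
have cv1 k : (cv k)`_1 = nv k.
  by rewrite /cv coefD coefC coefZ coefX mulr1 add0r.
have N0 i b : (i < 3)%N -> (scrollmx cv i b)`_0 = p i * r b.
  move=> i3; rewrite coef_scrollmx -scrollmx_psi //; congr scrollmx.
  exact/funext.
have N1 i b : (scrollmx cv i b)`_1 = N i b.
  by rewrite coef_scrollmx; congr scrollmx; apply/funext.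
have rank1 k b : (k < 3)%N -> p j * r a * N k b =
    p j * r b * N k a + p k * r a * N j b - p k * r b * N j a.
  move=> k3; have := tangent_coef1 EP tv (minor_form F a b j3 k3) (c := fun i => cv i).
  rewrite mmap_minor /minor coefB !coef1M !N0 // !N1 => E.
  apply/eqP; rewrite -subr_eq0 -[X in _ == X]E.
    by apply/eqP; rewrite /r; ring.
    by move=> i; rewrite cv0 mxE.
  by move=> i; rewrite cv1 /nv inord_val.
(* The splitting is determined up to adding c q to dq and -c r to dr; this choice makes [dr a]
   zero. *)
pose dq k := N k a / r a; pose dr b := (N j b - dq j * r b) / p j.
have Nqr k b : (k < 3)%N -> N k b = dq k * r b + p k * dr b.
  move=> k3; apply: (mulfI (mulf_neq0 nzj nza)); rewrite -/r rank1 //.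
  rewrite /dr /dq; rewrite -/r in nza.
  move: (N k a) (N j b) (N j a) (r b) (r a) nza (p k) (p j) nzj.
  by move=> x1 x2 x3 x4 x5 nz5 x6 x7 nz7; field; rewrite nz5 nz7.
(* Solved from N j b = N b j, using r k = 2 l q_k on the symmetric block. *)
pose dl := (dr j - 2 * p 3 * dq j) / p j / 2.
have rE k : (k < 3)%N -> r k = 2 * p 3 * p k by case: k => [|[|[|]]].
have dr3 b : (b < 3)%N -> dr b = 2 * (p 3 * dq b + dl * p b).
  move=> b3; have : N j b = N b j by rewrite /N scrollmxC.
  rewrite !Nqr // !rE // => E; apply: (mulfI nzj).
  have -> : p j * dr b = dq b * (2 * p 3 * p j) + p b * dr j - dq j * (2 * p 3 * p b).
    by rewrite -E; ring.
  rewrite /dl; move: (dr j) (dq j) (dq b) (p j) nzj => x1 x2 x3 x4 nz4.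
  by field; rewrite nz4.
pose w k := nth 0 [:: dq 0; dq 1; dq 2; dl; dr 3; dr 4 / 2; dr 5] k.
have drE b : (b < 6)%N -> drowpar p w b = dr b.
  do 6?[case: b => [|b]] => // _; rewrite /drowpar /w /=
    ?(dr3 0 isT, dr3 1 isT, dr3 2 isT) //.
  by field.
have Ev k : (k < 15)%N -> nv k = dpsi p w k.
  apply: (@scrollmx_inj F nv) => i b i3 b6; rewrite scrollmx_dpsi // drE // -/N Nqr //.
  by congr (_ * _ + _); case: (i) i3 => [|[|[|]]].
have vE : v = dpsiv p w.
  by apply/rowP => k; rewrite mxE -Ev ?ltn_ord // /nv inord_val.
exists w; split=> //; pose b i : {poly F} := (p i)%:P + w i *: 'X.
have bj : has_jet b p w.
  move=> i; rewrite /b !coefD !coefC !coefZ !coefX /=.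
  by rewrite mulr0 mulr1 addr0 add0r.
(* To first order [discquad] along the lifted curve is 4 q_j^2 [dhyp p w], because [hyp p] is
   zero. *)
have := tangent_coef1 EP tv (discquad_form F j3) (c := fun i => psi b i).
rewrite mmap_discquad discquad_psi // coef1M (coef0_hyp bj) hp (coef1_hyp bj) mulr0 addr0.
rewrite coef0M expr2 coef0M -polyC_natr coefC /=; have [-> _] := bj j.
move=> E; have : 4 * (p j * p j) * dhyp p w = 0.
  apply: E => k; first by rewrite (coef0_psi _ bj) mxE.
  by rewrite (coef1_psi bj) ?ltn_ord // vE mxE.
by move/eqP; rewrite !mulf_eq0 (negPf nzj) pnatr_eq0 /= => /eqP.
Qed.

End TangentUpper.

(** * Dimension of the space of tangent vectors *)

Section TangentDim.
Variables (F : numClosedFieldType) (p : nat -> F).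

Definition coords (x : 'rV[F]_7) (i : nat) : F := x ord0 (inord i).
Definition dpsiL (x : 'rV[F]_7) : 'rV[F]_15 := dpsiv p (coords x).
Definition dhypL (x : 'rV[F]_7) : 'rV[F]_1 := const_mx (dhyp p (coords x)).

Lemma coordsZD a x y i : coords (a *: x + y) i = a * coords x i + coords y i.
Proof. by rewrite /coords !mxE. Qed.

Fact dpsiL_is_linear : linear dpsiL.
Proof.
move=> a x y; apply/rowP => -[k k15]; rewrite !mxE /dpsi /=.
by do 15?[case: k k15 => [|k] k15] => //;
  rewrite /unscroll /rowpar /drowpar /= !coordsZD; ring.
Qed.

Fact dhypL_is_linear : linear dhypL.
Proof. by move=> a x y; apply/rowP => k; rewrite !mxE /dhyp !coordsZD; ring. Qed.

HB.instance Definition _ :=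
  GRing.isLinear.Build F 'rV[F]_7 'rV[F]_15 _ dpsiL dpsiL_is_linear.
HB.instance Definition _ :=
  GRing.isLinear.Build F 'rV[F]_7 'rV[F]_1 _ dhypL dhypL_is_linear.

(** The affine cone over the embedded tangent space. Its dimension is 7 - 1 - 1 = 5: one for the
    equation [dhyp], one for the scaling direction. *)
Definition tangent_cone : {vspace 'rV[F]_15} :=
  (linfun dpsiL @: lker (linfun dhypL))%VS.

Lemma coords_row (w : nat -> F) i : (i < 7)%N ->
  coords (\row_k w k) i = w i.
Proof. by move=> i7; rewrite /coords mxE inordK. Qed.

Lemma dpsi_row (w : nat -> F) : dpsiL (\row_k w k) = dpsiv p w.
Proof.
apply/rowP => k; rewrite !mxE /dpsi /unscroll /rowpar /drowpar /=.
by rewrite !coords_row.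
Qed.

Lemma dhyp_row (w : nat -> F) : dhypL (\row_k w k) = const_mx (dhyp p w).
Proof. by apply/rowP => k; rewrite !mxE /dhyp !coords_row. Qed.

Lemma mem_tangent_cone v :
  v \in tangent_cone <-> exists w, dhyp p w = 0 /\ v = dpsiv p w.
Proof.
split.
  case/memv_imgP => x; rewrite memv_ker !lfunE /= => /eqP/rowP/(_ ord0) hx ->.
  by exists (coords x); rewrite !mxE in hx.
case=> w [dw ->]; apply/memv_imgP; exists (\row_k w k); last first.
  by rewrite lfunE /= dpsi_row.
by rewrite memv_ker lfunE /= dhyp_row dw; apply/eqP/rowP => k; rewrite !mxE.
Qed.

Hypotheses (hp : hyp p = 0) (nzp : psiv p != 0).

(* psi is constant along (q, l, t) |-> (a q, a^-2 l, a^-1 t). *)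
Definition scaling_dir (i : nat) : F :=
  nth 0 [:: p 0; p 1; p 2; - 2 * p 3; - p 4; - p 5; - p 6] i.

(** The hypersurface is smooth where [psiv] is nonzero: if every partial derivative vanishes then t
    = 0, hence l <> 0, hence q = 0, a contradiction. *)
Lemma dim_lker_dhyp : \dim (lker (linfun dhypL)) = 6%N.
Proof.
have := limg_ker_dim (linfun dhypL) fullv.
rewrite capfv dimvf /dim /= => E.
have le1 : (\dim (limg (linfun dhypL)) <= 1)%N.
  by have := dimvS (subvf (limg (linfun dhypL))); rewrite dimvf /dim /= muln1.
suff ne0 : (0 < \dim (limg (linfun dhypL)))%N.
  have d1 : \dim (limg (linfun dhypL)) = 1%N by apply/eqP; rewrite eqn_leq le1.
  by move: E; rewrite d1 addn1 mul1n => -[].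
rewrite lt0n dimv_eq0; apply/negP => /eqP lim0.
have d0 w : dhyp p w = 0.
  have : linfun dhypL (\row_k w k) \in limg (linfun dhypL) by rewrite memv_img ?memvf.
  rewrite lim0 memv0 lfunE /= dhyp_row => /eqP/rowP/(_ ord0).
  by rewrite !mxE.
have nz2 : (2 : F) != 0 by rewrite pnatr_eq0.
pose e k (i : nat) : F := (i == k)%:R.
have nz4 : (4 : F) != 0 by rewrite pnatr_eq0.
have D5 : dhyp p (e 5%N) = 2 * p 5 by rewrite /dhyp /e /=; ring.
have D6 : dhyp p (e 6%N) = - p 4 by rewrite /dhyp /e /=; ring.
have D4 : dhyp p (e 4%N) = - p 6 by rewrite /dhyp /e /=; ring.
have D0 : dhyp p (e 0%N) = 4 * p 3 ^+ 2 * p 2 by rewrite /dhyp /e /=; ring.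
have D1 : dhyp p (e 1%N) = - (2 * p 3 ^+ 2 * p 1) by rewrite /dhyp /e /=; ring.
have D2 : dhyp p (e 2%N) = 4 * p 3 ^+ 2 * p 0 by rewrite /dhyp /e /=; ring.
have t1 : p 5 = 0 by move/eqP: D5; rewrite d0 eq_sym mulf_eq0 (negPf nz2) => /eqP.
have t0 : p 4 = 0 by move/eqP: D6; rewrite d0 eq_sym oppr_eq0 => /eqP.
have t2 : p 6 = 0 by move/eqP: D4; rewrite d0 eq_sym oppr_eq0 => /eqP.
have [j [a [j3 a6 nzj nza]]] := psiv_neq0 nzp.
have nzl : p 3 != 0.
  apply: contra nza => /eqP l0; rewrite /rowpar l0 t0 t1 t2 !mulr0 !mul0r.
  by do 6?[case: a a6 => [|a] a6] => //=; rewrite eqxx.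
move: D0 D1 D2; rewrite !d0 => /esym/eqP D0 /esym/eqP D1 /esym/eqP D2.
rewrite oppr_eq0 in D1; rewrite !mulf_eq0 (negPf nzl) (negPf nz4) (negPf nz2) /= in D0 D1 D2.
by case: j j3 nzj => [|[|[|//]]] _; rewrite ?D0 ?D1 ?D2.
Qed.

Lemma dpsi_scaling : dpsiv p scaling_dir = 0.
Proof.
apply/rowP => k; rewrite !mxE.
apply: (@scrollmx_inj F (dpsi p scaling_dir) (fun=> 0)) (ltn_ord k) => j a j3 a6.
rewrite scrollmx_dpsi //; transitivity (0 : F).
  do 6?[case: a a6 => [|a] a6] => //; rewrite /rowpar /drowpar /scaling_dir /=;
  by case: j j3 => [|[|[|//]]] _ /=; ring.
case: j j3 => [|[|[|//]]] _; do 6?[case: a a6 => [|a] a6] => //;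
by rewrite /scrollmx /= ?mulr0 ?subr0 ?addr0.
Qed.

(** Euler's relation: [hyp] has weight -2 under the scaling. *)
Lemma dhyp_scaling : dhyp p scaling_dir = 0.
Proof.
have -> : dhyp p scaling_dir = - 2 * hyp p by rewrite /dhyp /hyp /scaling_dir /=; ring.
by rewrite hp mulr0.
Qed.

(** From dq r + q dr = 0 with q and r nonzero follow dq = c q and dr = -c r; reading off dr then
    gives the l and t components. *)
Lemma dpsi_kernel w : dpsiv p w = 0 ->
  exists c, forall i, (i < 7)%N -> w i = c * scaling_dir i.
Proof.
move=> w0; have [j [a [j3 a6 nzj nza]]] := psiv_neq0 nzp.
have nz2 : (2 : F) != 0 by rewrite pnatr_eq0.
have E k b : (k < 3)%N -> (b < 6)%N ->
    w k * rowpar p b + p k * drowpar p w b = 0.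
  move=> k3 b6; rewrite -scrollmx_dpsi //.
  have Z i : (i < 15)%N -> dpsi p w i = 0.
    by move=> i15; have /rowP/(_ (Ordinal i15)) := w0; rewrite !mxE.
  case: k k3 => [|[|[|//]]] _; do 6?[case: b b6 => [|b] b6] => //;
  by rewrite /scrollmx /= !Z // ?mulr0 ?subr0 ?addr0.
pose c := - drowpar p w a / rowpar p a.
have wq k : (k < 3)%N -> w k = c * p k.
  move=> k3; apply: (mulIf nza); rewrite /c mulrAC divfK // mulNr.
  by apply/eqP; rewrite -subr_eq0 opprK [_ * p k]mulrC E.
have dr b : (b < 6)%N -> drowpar p w b = - c * rowpar p b.
  move=> b6; apply: (mulfI nzj); apply/eqP; rewrite -subr_eq0 -(E j b j3 b6) wq //.
  by apply/eqP; ring.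
exists c => i i7; rewrite /scaling_dir; do 3?[case: i i7 => [|i] i7; first by rewrite wq].
case: i i7 => [|i] i7 /=.
  have Ej : drowpar p w j = 2 * (p 3 * w j + w 3 * p j) by case: (j) j3 => [|[|[|]]].
  have rj : rowpar p j = 2 * p 3 * p j by case: (j) j3 => [|[|[|]]].
  apply: (mulIf nzj); apply: (mulfI nz2).
  have := dr j (leq_trans j3 (isT : (3 <= 6)%N)); rewrite Ej rj wq // => /eqP.
  rewrite -subr_eq0 => /eqP Z; apply/eqP; rewrite -subr_eq0 -[X in _ == X]Z.
  by apply/eqP; ring.
have := dr 3%N isT; have := dr 4%N isT; have := dr 5%N isT.
rewrite /drowpar /rowpar /= => d5 d4 d3.
case: i i7 => [|i] i7 /=; first by rewrite d3 mulrN mulNr.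
case: i i7 => [|i] i7 /=; first by apply: (mulfI nz2); rewrite d4; ring.
by case: i i7 => [|//] _ /=; rewrite d5 mulrN mulNr.
Qed.

Lemma dim_tangent_cone : \dim tangent_cone = 5%N.
Proof.
have := limg_ker_dim (linfun dpsiL) (lker (linfun dhypL)).
rewrite dim_lker_dhyp -/tangent_cone.
suff -> : \dim (lker (linfun dhypL) :&: lker (linfun dpsiL))%VS = 1%N.
  by rewrite add1n => -[].
pose z : 'rV[F]_7 := \row_k scaling_dir k.
have nzz : z != 0.
  have [j [a [j3 a6 nzj nza]]] := psiv_neq0 nzp.
  apply: contra nzj => /eqP/rowP/(_ (inord j)); rewrite !mxE inordK ?(leq_trans j3) //=.
  by case: (j) j3 => [|[|[|//]]] _ /eqP.
have -> : (lker (linfun dhypL) :&: lker (linfun dpsiL))%VS = <[z]>%VS.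
  apply/vspaceP => x; rewrite memv_cap !memv_ker !lfunE /=.
  apply/andP/vlineP => [[_ /eqP x0]|[c ->]]; last first.
    rewrite !linearZ /= dpsi_row dhyp_row dpsi_scaling dhyp_scaling scaler0 eqxx.
    by split=> //; apply/eqP/rowP => k; rewrite !mxE mulr0.
  have [c Ec] := dpsi_kernel x0; exists c; apply/rowP => k.
  by rewrite !mxE -Ec ?ltn_ord // /coords inord_val.
by rewrite dim_vline nzz.
Qed.

End TangentDim.

Lemma secvar_tangent_dim (F : numClosedFieldType) (P : proj F 14) :
  secvar P -> tangent_space_dim (@secvar F) P 4.
Proof.
move=> [p [hp EP]]; exists (tangent_cone p); split; last first.
  exact: dim_tangent_cone (proj_vec_neq0 EP).
move=> v; split=> [/mem_tangent_cone[w [dw ->]]|tv].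
  exact: tangent_dpsi.
by apply/mem_tangent_cone; apply: tangent_lift tv.
Qed.

(** * Bounding the length of chains *)

Lemma exists_relation (F : fieldType) (I J : finType) (M : I -> J -> F) :
  (#|J| < #|I|)%N ->
  exists c : I -> F, (exists i, c i != 0) /\ forall j, \sum_i c i * M i j = 0.
Proof.
move=> ltJI; pose A := \matrix_(i < #|I|, j < #|J|) M (enum_val i) (enum_val j).
have : kermx A != 0.
  by rewrite -mxrank_eq0 mxrank_ker -lt0n subn_gt0 (leq_ltn_trans (rank_leq_col _)).
case/rowV0Pn => v /sub_kermxP vA /rV0Pn[i nzi].
exists (fun i => v ord0 (enum_rank i)); split.
  by exists (enum_val i); rewrite enum_valK.
move=> j; have /rowP/(_ (enum_rank j)) := vA; rewrite !mxE => E.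
rewrite -[RHS]E [RHS](reindex _ (onW_bij _ (@enum_rank_bij I))) /=.
by apply: eq_bigr => k _; rewrite mxE !enum_rankK.
Qed.

(** A crude count: each of the m exponents is below b. *)
Lemma card_bmultinom m b : (#|{: 'X_{1..m < b}}| <= b ^ m)%N.
Proof.
have lt_b (x : 'X_{1..m < b}) i : (x i < b)%N.
  apply: leq_ltn_trans (bmdeg x); rewrite mdegE (bigD1 i) //=; exact: leq_addr.
pose h (x : 'X_{1..m < b}) := [ffun i => Ordinal (lt_b x i)].
have h_inj : injective h.
  move=> x y /ffunP E; apply/val_inj/mnmP => i.
  by have := E i; rewrite !ffunE => /(congr1 val).
by rewrite -(card_codom h_inj) (leq_trans (max_card _)) // card_ffun !card_ord.
Qed.

Section DegreeBound.
Variables (m : nat) (R : idomainType).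
Implicit Types p q : {mpoly R[m]}.

Lemma msizeM_leq p q a b :
  (msize p <= a.+1)%N -> (msize q <= b.+1)%N -> (msize (p * q)%R <= (a + b).+1)%N.
Proof.
have [->|nzp] := eqVneq p 0; first by rewrite mul0r msize0.
have [->|nzq] := eqVneq q 0; first by rewrite mulr0 msize0.
move=> pa qb; rewrite msizeM // -subn1 leq_subLR add1n.
by apply: leq_trans (leq_add pa qb) _; rewrite addnS.
Qed.

Lemma msizeX_leq p a k : (msize p <= a.+1)%N -> (msize (p ^+ k)%R <= (a * k).+1)%N.
Proof.
move=> pa; elim: k => [|k IH]; first by rewrite expr0 msize1 muln0.
by rewrite exprS mulnS msizeM_leq.
Qed.

Lemma msize_comp_homog n (f : {mpoly R[n]}) (G : 'I_n -> {mpoly R[m]}) d s :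
  f \is d.-homog -> (forall i, (msize (G i) <= s.+1)%N) ->
  (msize (mmap (@mpolyC m R) G f) <= (s * d).+1)%N.
Proof.
move=> /dhomogP fd Gs; rewrite /mmap; apply: leq_trans (msize_sum _ _ _) _.
apply/bigmax_leqP_seq => k kf _; rewrite mul_mpolyC.
apply: leq_trans (msizeZ_le _ _) _; have <- : mdeg k = d := fd k kf.
rewrite /mmap1 mdegE big_distrr /=.
elim/big_ind2: _ => [|p a q b|i _]; first by rewrite msize1.
  exact: msizeM_leq.
exact: msizeX_leq.
Qed.

End DegreeBound.

Section IrreducibleSets.
Variables (F : fieldType) (n : nat).
Implicit Types (Z : proj F n -> Prop) (f g : {mpoly F[n.+1]}).

Lemma irreducible_formM Z f g : zirreducible Z -> is_form f -> is_form g ->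
  (forall P, Z P -> vanishes_at (f * g) P) ->
  (forall P, Z P -> vanishes_at f P) \/ (forall P, Z P -> vanishes_at g P).
Proof.
move=> [_ irr] ff fg fgZ.
apply: (irr _ _ (zclosed_vanishes ff) (zclosed_vanishes fg)) => P ZP.
have [u EP] := proj_vecP P; have [[d fd] [e ge]] := (ff, fg).
have : (f * g).@[u ord0] = 0 by apply: fgZ ZP _ _; rewrite EP memv_line.
rewrite mevalM => /eqP; rewrite mulf_eq0 => /orP[] /eqP E; [left|right].
  exact/(vanishes_atE fd EP).
exact/(vanishes_atE ge EP).
Qed.

Lemma irreducible_formX Z f k : zirreducible Z -> is_form f ->
  (forall P, Z P -> vanishes_at (f ^+ k) P) -> forall P, Z P -> vanishes_at f P.
Proof.
move=> [[P0 ZP0] irr] [d fd] fZ P ZP v vP; apply/eqP.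
have : (f ^+ k).@[v ord0] = 0 by apply: fZ ZP _ _.
by rewrite rmorphXn /= => /eqP; rewrite expf_eq0 => /andP[].
Qed.

End IrreducibleSets.

(** Exponent vectors in {0, ..., D}^r, as nested pairs so that the last form can be split off by
    recursion. *)
Fixpoint box (D r : nat) : finType :=
  if r is r'.+1 then ('I_D.+1 * box D r')%type : finType else unit.

Lemma card_box D r : #|box D r| = (D.+1 ^ r)%N.
Proof.
elim: r => [|r IH] /=; first by rewrite card_unit.
by rewrite card_prod IH card_ord expnS.
Qed.

(** * Algebraic relations bound the length of chains *)

Section DimensionBound.
Variables (F : fieldType) (n : nat) (X : proj F n -> Prop).
Variables (m : nat) (G : 'I_n.+1 -> {mpoly F[m]}).
(** Algebraic version of: X lies in the closure of the image of affine m-space under G. *)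
Hypothesis G_dense : forall f, is_form f -> mmap (@mpolyC m F) G f = 0 ->
  forall P, X P -> vanishes_at f P.

Section Monomials.
Variables (D : nat) (x0 : {mpoly F[n.+1]}) (f : nat -> {mpoly F[n.+1]}).
Variable (d : nat -> nat).
Hypotheses (x0_homog : x0 \is 1.-homog) (f_homog : forall i, f i \is (d i).-homog).

(** Powers of x0 pad each f_i^e to degree d_i D, so that all box monomials have the same degree. *)
Fixpoint boxmon (r : nat) : box D r -> {mpoly F[n.+1]} :=
  if r is r'.+1 return box D r -> _ then
    fun b => f r' ^+ b.1 * x0 ^+ (d r' * (D - b.1)) * boxmon b.2
  else fun=> 1.

Definition boxform r (c : box D r -> F) := \sum_b c b *: boxmon b.

Definition boxdeg r := (\sum_(i < r) d i * D)%N.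

Lemma boxmon_homog r (b : box D r) : boxmon b \is (boxdeg r).-homog.
Proof.
elim: r b => [|r IH] b /=; first by rewrite /boxdeg big_ord0 dhomog1.
rewrite /boxdeg big_ord_recr /= addnC; apply: dhomogM (IH _).
have -> : (d r * D = d r * b.1 + 1 * (d r * (D - b.1)))%N.
  by rewrite mul1n -mulnDr subnKC // -ltnS.
by apply: dhomogM; apply: dhomogMn.
Qed.

Lemma boxform_homog r (c : box D r -> F) : boxform c \is (boxdeg r).-homog.
Proof. by rewrite rpred_sum // => b _; rewrite rpredZ ?boxmon_homog. Qed.

Lemma boxformS r (c : box D r.+1 -> F) :
  boxform c = \sum_(e < D.+1) f r ^+ e * x0 ^+ (d r * (D - e))
    * boxform (fun b => c (e, b)).
Proof.
rewrite /boxform; under [RHS]eq_bigr do rewrite mulr_sumr.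
rewrite pair_big /=; apply: eq_bigr => -[e b] _ /=.
by rewrite -scalerAr.
Qed.

Lemma boxform0 r (c : box D r -> F) : (forall b, c b = 0) -> boxform c = 0.
Proof. by move=> c0; rewrite /boxform big1 // => b _; rewrite c0 scale0r. Qed.

(* Peeling off the lowest power of f_r: since f_r does not vanish on Z_(r+1)
   but does on Z_r, a relation on Z_(r+1) yields one with fewer forms on Z_r. *)
Lemma boxform_nonvanishing (Z : nat -> proj F n -> Prop) (P0 : proj F n) k :
    Z 0 P0 -> ~ vanishes_at x0 P0 ->
    (forall i, (i <= k)%N -> zirreducible (Z i)) ->
    (forall i, (i < k)%N -> [/\ psub (Z i) (Z i.+1),
       forall P, Z i P -> vanishes_at (f i) P
     & ~ forall P, Z i.+1 P -> vanishes_at (f i) P]) ->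
  forall r (c : box D r -> F), (r <= k)%N -> (exists b, c b != 0) ->
    ~ forall P, Z r P -> vanishes_at (boxform c) P.
Proof.
move=> Z0 nx0 irr chain; elim=> [|r IH] c rk [b0 nzb0] cZ.
  have [u EP] := proj_vecP P0; have uP : u \in val P0 by rewrite EP memv_line.
  have := cZ _ Z0 _ uP; rewrite /boxform (bigD1 tt) //= big1 => [|[] //].
  rewrite addr0 mevalZ meval1 mulr1 => /eqP; case: b0 nzb0 => nz0.
  by rewrite (negPf nz0).
have [sZ fZ nfZ] := chain r rk.
have P0r i : (i <= k)%N -> Z i P0.
  elim: i => // i IHi ik; have [s _ _] := chain i ik; apply/s/IHi/ltnW/ik.
(* The lowest exponent of [f r] that occurs in the relation; below, A collects its terms, with
   [f r ^+ e0] removed, and B the higher ones. *)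
have [e0 nze0 min_e0] := @arg_minnP _ b0.1 (fun e => [exists b, c (e, b) != 0])
  (fun e : 'I_D.+1 => (e : nat)) (introT existsP (ex_intro _ b0.2 (eq_ind _ (fun x => c x != 0) nzb0 _ (surjective_pairing b0)))).
pose A := x0 ^+ (d r * (D - e0)) * boxform (fun b => c (e0, b)).
pose B := \sum_(e < D.+1 | (e0 < e)%N) f r ^+ (e - e0.+1) * x0 ^+ (d r * (D - e))
    * boxform (fun b => c (e, b)).
have Ec : boxform c = f r ^+ e0 * (A + f r * B).
  rewrite boxformS (bigID (fun e : 'I_D.+1 => (e <= e0)%N)) /= mulrDr; congr (_ + _).
    rewrite (bigD1 e0) //= big1 ?addr0 => [|e /andP[ele ne]].
      by rewrite /A mulrA.
    rewrite boxform0 ?mulr0 // => b; apply/eqP; apply: contraNT ne => nz.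
    by rewrite -val_eqE eqn_leq ele min_e0 //; apply/existsP; exists b.
  rewrite /B !mulr_sumr; apply: eq_big => [e|e]; first by rewrite -ltnNge.
  rewrite -ltnNge => lt; rewrite !mulrA; do 2!congr (_ * _).
  by rewrite -exprSr -exprD subnKC.
have Ah : A \is (d r * (D - e0) + boxdeg r).-homog.
  apply: dhomogM (boxform_homog _).
  by have := dhomogMn (d r * (D - e0)) x0_homog; rewrite mul1n.
have Bh : f r * B \is (d r * (D - e0) + boxdeg r).-homog.
  rewrite /B mulr_sumr rpred_sum // => e lt; rewrite !mulrA -exprS.
  apply: dhomogM (boxform_homog _).
  have -> : (d r * (D - e0) = d r * (e - e0.+1).+1 + 1 * (d r * (D - e)))%N.
    rewrite mul1n -mulnDr; congr (_ * _)%N.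
    by rewrite -subSn // subSS addnC addnBA 1?ltnW // subnK // -ltnS.
  by apply: dhomogM; apply: dhomogMn.
have ABf : is_form (A + f r * B) by eexists; apply: rpredD Ah Bh.
have ff : is_form (f r) by exists (d r).
have irrS := irr _ rk.
have feX : is_form (f r ^+ e0) by exists (d r * e0)%N; apply: dhomogMn.
have [fe0|ABZ] := irreducible_formM irrS feX ABf (eq_ind _ (fun g => forall P, _ P -> vanishes_at g P) cZ _ Ec).
  by apply: nfZ; apply: irreducible_formX irrS ff fe0.
apply: (IH (fun b => c (e0, b)) (ltnW rk)); first by case/existsP: nze0 => b; exists b.
have AZ P : Z r P -> vanishes_at A P.
  move=> ZP v vP; have := ABZ P (sZ _ ZP) v vP.
  by rewrite mevalD (mevalM _ (f r)) (fZ P ZP v vP) mul0r addr0.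
have irr_r := irr _ (ltnW rk).
have xf : is_form (x0 ^+ (d r * (D - e0))).
  by exists (1 * (d r * (D - e0)))%N; apply: dhomogMn.
have bf : is_form (boxform (fun b => c (e0, b))) by exists (boxdeg r); apply: boxform_homog.
(* The padding power of x0 cancels: x0 is nonzero at P0, which lies on every member of the chain. *)
have [x00|//] := irreducible_formM irr_r xf bf AZ.
case: nx0; apply: (irreducible_formX irr_r _ x00) (P0r _ (ltnW rk)).
by exists 1%N.
Qed.

End Monomials.

(** Given m + 1 strict inclusions, let [f i] vanish on [Z i] but not on [Z i.+1]. There are more box
    monomials in [f 0], ..., [f m] than monomials in m variables available to their pullbacks, so a
    nontrivial [boxform] vanishes on X, against [boxform_nonvanishing]. *)
Lemma irr_chain_length k Z : irr_chain X k Z -> (k <= m)%N.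
Proof.
move=> [Zirr Zlt]; rewrite leqNgt; apply/negP => ltmk.
have irr i : (i <= k)%N -> zirreducible (Z i) by case/Zirr.
have [[P0 Z0] _] := irr 0%N isT.
have [u EP] := proj_vecP P0; have /rV0Pn[i0 nzi0] := proj_vec_neq0 EP.
pose x0 : {mpoly F[n.+1]} := 'X_i0.
have x0h : x0 \is 1.-homog by rewrite dhomogX /= mdeg1.
have nx0 : ~ vanishes_at x0 P0.
  by move/(vanishes_atE x0h EP); rewrite mevalXU; apply/eqP.
have /choice[fd Hfd] i : exists fd : {mpoly F[n.+1]} * nat, (fd.1 \is fd.2.-homog) /\
    ((i < k)%N -> (forall P, Z i P -> vanishes_at fd.1 P) /\
      ~ forall P, Z i.+1 P -> vanishes_at fd.1 P).
  have [ik|_] := ltnP i k; last by exists (0, 0%N); split; rewrite ?dhomog0.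
  have [_ /existsNP[P /not_implyP[ZP nZP]]] := Zlt i ik.
  have [[S [Sf SZ]] _ _] := Zirr i (ltnW ik).
  have [f /not_implyP[Sff nf]] : exists f, ~ (S f -> vanishes_at f P).
    by apply/existsNP; rewrite -SZ.
  have [d fdh] := Sf _ Sff; exists (f, d); split=> // _; split.
    by move=> Q /SZ; apply.
  by move/(_ P ZP).
pose f i := (fd i).1; pose d i := (fd i).2.
have fh i : f i \is (d i).-homog by case: (Hfd i).
pose s := \max_i msize (G i).
have Gs i : (msize (G i) <= s.+1)%N by rewrite leqW // (leq_bigmax i).
(* B is at most K (D + 1), so the choice D = K^m gives B^m <= D (D + 1)^m < (D + 1)^(m + 1). *)
pose K := (s * \sum_(i < m.+1) d i).+1; pose D := (K ^ m)%N.
pose B := (s * boxdeg D d m.+1).+1.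
have ltcard : (#|{: 'X_{1..m < B}}| < #|box D m.+1|)%N.
  rewrite card_box; apply: leq_ltn_trans (card_bmultinom _ _) _.
  apply: (@leq_ltn_trans ((D.+1 * K) ^ m)); last first.
    by rewrite expnMn -/D mulnC expnS ltn_pmul2r ?expn_gt0.
  have : (B <= D.+1 * K)%N.
    rewrite /B /boxdeg -big_distrl /= mulnA /K mulSn mulnS addSn ltnS.
    by rewrite [(D * _)%N]mulnC addnA leq_addl.
  by case: (m) => // m'; rewrite leq_exp2r.
have [c [[b nzb] c0]] := exists_relation
  (fun (b : box D m.+1) (j : 'X_{1..m < B}) => (mmap (@mpolyC m F) G (boxmon x0 f d b))@_j)
  ltcard.
have nonv := @boxform_nonvanishing D x0 f d x0h fh Z P0 k Z0 nx0 irr _ m.+1 c ltmk (ex_intro _ b nzb).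
apply: nonv => [i ik|P ZP].
  have [s1 _] := Zlt i ik; have [_ /(_ ik)[s2 s3]] := Hfd i.
  by split.
have [_ _ ZX] := Zirr _ ltmk.
have bf : boxform x0 f d c \is (boxdeg D d m.+1).-homog by apply: boxform_homog.
have bff : is_form (boxform x0 f d c) by exists (boxdeg D d m.+1).
apply: (G_dense bff); last exact: ZX ZP.
have EQ : mmap (@mpolyC m F) G (boxform x0 f d c) =
    \sum_b c b *: mmap (@mpolyC m F) G (boxmon x0 f d b).
  rewrite /boxform raddf_sum; apply: eq_bigr => b' _.
  by rewrite /= mmapZ mul_mpolyC.
apply/mpolyP => j; rewrite mcoeff0.
(* Coefficients of degree below B vanish by the choice of c, the others by the degree bound on the
   pullback. *)
have [jB|Bj] := ltnP (mdeg j) B.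
  rewrite EQ raddf_sum /= -[RHS](c0 (BMultinom jB)).
  by apply: eq_bigr => b' _; rewrite mcoeffZ.
apply: memN_msupp_eq0; apply: msize_mdeg_ge; apply: leq_trans Bj.
exact: msize_comp_homog bf Gs.
Qed.

End DimensionBound.

(** * The upper bound 4 on the dimension *)

Section SecvarDim.
Variable F : numClosedFieldType.

(* The chart q0 = l = 1, where q2 is determined by q1, t0, t1, t2. *)
Definition chart (i : nat) : {mpoly F[4]} :=
  let q1 := 'X_(inord 0) in let t0 := 'X_(inord 1) in
  let t1 := 'X_(inord 2) in let t2 := 'X_(inord 3) in
  nth 0 [:: 1; q1; (4^-1)%:MP * (q1 ^+ 2 - t1 ^+ 2 + t0 * t2); 1; t0; t1; t2] i.

(** Coordinate 2 is 2 l q0^2. Its product with f vanishes on the whole variety, off the chart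
    because of that coordinate; irreducibility and [secvar_witness] leave f. *)
Lemma chart_dense (f : {mpoly F[15]}) : is_form f ->
  mmap (@mpolyC 4 F) (fun k : 'I_15 => psi chart k) f = 0 ->
  forall P, secvar P -> vanishes_at f P.
Proof.
move=> ff f0; have X2f : is_form (@Xs F 2) by exists 1%N; apply: Xs_homog.
have [d fd] := ff.
have nz4 : (4 : F) != 0 by rewrite pnatr_eq0.
have [|X20|//] := irreducible_formM (@secvar_irreducible F) X2f ff.
  move=> P [p [hp EP]]; apply/(vanishes_atE (dhomogM (@Xs_homog F 2) fd) EP).
  rewrite mevalM mevalXU mxE inordK //= /psi /=.
  have [->|nzl] := eqVneq (p 3) 0; first by rewrite mulr0 !mul0r.
  have [->|nzq] := eqVneq (p 0) 0; first by rewrite expr0n mulr0 mul0r.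
  (* Substituting q = q0 q' and t = l q0 t' pulls the factor l q0^2 out of [psi] and turns [hyp]
     into the equation of the chart. *)
  pose a := fun i : 'I_4 => nth 0 [:: p 1 / p 0; p 4 / (p 3 * p 0);
     p 5 / (p 3 * p 0); p 6 / (p 3 * p 0)] i.
  pose pc i := nth 0 [:: 1; p 1 / p 0; p 2 / p 0; 1; p 4 / (p 3 * p 0);
     p 5 / (p 3 * p 0); p 6 / (p 3 * p 0)] i.
  have E5 : p 5 ^+ 2 = p 4 * p 6 + p 3 ^+ 2 * (p 1 ^+ 2 - 4 * p 0 * p 2).
    by apply/eqP; rewrite -subr_eq0 -[X in _ == X]hp /hyp; apply/eqP; ring.
  have Epc i : (chart i).@[a] = pc i.
    do 7?[case: i => [|i]]; rewrite /chart /pc /= ?nth_nil ?meval0 ?meval1 //;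
      rewrite ?(mevalM, mevalC, mevalD, mevalN, mevalXU) /a ?inordK //=.
    rewrite -!expr2 [(p 5 / _) ^+ 2]expr_div_n E5.
    by field; rewrite nzl nzq.
  have Ea : psiv p ord0 =1 fun k => p 3 * p 0 ^+ 2 * psi (fun i => (chart i).@[a]) k.
    move=> [k k15]; rewrite mxE (_ : (fun i => _) = pc); last exact/funext.
    by do 15?[case: k k15 => [|k] k15] => //; rewrite /psi /pc /=; field;
      rewrite ?nzl ?nzq.
  rewrite (meval_eq _ Ea) (meval_homogZ _ _ fd).
  have -> : f.@[fun k : 'I_15 => psi (fun i => (chart i).@[a]) k] = 0.
    have <- : (mmap (@mpolyC 4 F) (fun k : 'I_15 => psi chart k) f).@[a] = 0.
      by rewrite f0 meval0.
    rewrite rmorph_mmap; apply: eq_mmap => [x|k] /=; first by rewrite mevalC.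
    by rewrite rmorph_psi.
  by rewrite !mulr0.
have [p [hp nz2 nzp]] := secvar_witness F; have [P EP] := proj_of_vec nzp.
have XP : secvar P by exists p.
have /(vanishes_atE (@Xs_homog F 2) EP) := X20 P XP.
by rewrite mevalXU mxE inordK // => /eqP; rewrite (negPf nz2).
Qed.

Lemma secvar_chain_length k Z : irr_chain (@secvar F) k Z -> (k <= 4)%N.
Proof. exact: irr_chain_length chart_dense k Z. Qed.

End SecvarDim.

(** * A chain of length 4 *)

Section Flag.
Variable F : numClosedFieldType.
Implicit Types (y p : nat -> F) (P : proj F 14).

(* (q0, q1, q2, x0, x1) with t = (x0^2, x0 x1, x1^2) parametrizes l = 0. *)
Definition flagpar (S : comNzRingType) (y : nat -> S) (i : nat) : S :=
  nth 0 [:: y 0; y 1; y 2; 0; y 3 ^+ 2; y 3 * y 4; y 4 ^+ 2] i.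

(** Starting from l = 0 at i = 3, the parameters x1, q2, q1 are set to zero in turn, until a single
    point is left at i = 0. *)
Definition flag_zeros (i : nat) : seq nat := take (3 - i) [:: 4; 2; 1]%N.

Definition flag (i : nat) P : Prop :=
  if (i <= 3)%N then exists y, (forall k, k \in flag_zeros i -> y k = 0) /\
      val P = <[psiv (flagpar y)]>%VS
  else secvar P.

Lemma hyp_flagpar (S : comNzRingType) (y : nat -> S) : hyp (flagpar y) = 0.
Proof. by rewrite /hyp /flagpar /=; ring. Qed.

Lemma flag_secvar i P : flag i P -> secvar P.
Proof.
rewrite /flag; case: ifP => // _ [y [_ EP]].
by exists (flagpar y); rewrite hyp_flagpar.
Qed.

(** Segments in the parameters y join any two points, since the conditions on y are linear. *)
Lemma flag_irreducible_small i : (i <= 3)%N -> zirreducible (flag i).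
Proof.
move=> i3; apply: zirreducible_curves.
  pose y (k : nat) : F := ((k == 0) || (k == 3))%N%:R.
  have nz : psiv (flagpar y) != 0.
    apply/eqP => /rowP/(_ (inord 0)); rewrite !mxE inordK // /psi /flagpar /y /=.
    by move/eqP; rewrite expr1n mulr1 oner_eq0.
  have [P EP] := proj_of_vec nz; exists P; rewrite /flag i3; exists y; split=> //.
  by move=> k /mem_take; rewrite !inE => /or3P[] /eqP ->.
move=> P P'; rewrite /flag i3 => -[y [y0 EP]] [y' [y0' EP']].
pose yl k : {poly F} := (y k)%:P + (y' k - y k) *: 'X.
pose c (k : 'I_15) : {poly F} := psi (flagpar yl) k.
pose ya (a : F) k := y k + (y' k - y k) * a.
have Ec a k : (c k).[a] = psi (flagpar (ya a)) k.
  rewrite /c -[LHS]/(horner_eval a _) rmorph_psi; congr psi; apply: funext => j /=.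
  do 7?[case: j => [|j]]; rewrite /horner_eval /flagpar /= ?nth_nil /yl /ya;
  by rewrite !hornerE.
exists F, (fun a => psiv (flagpar (ya a))); split.
- move=> a Q EQ; exists (ya a); split=> // k kz.
  by rewrite /ya y0 // y0' // subrr mul0r addr0.
- exists 0; rewrite EP; congr <[psiv (flagpar _)]>%VS; apply: funext => k.
  by rewrite /ya mulr0 addr0.
- exists 1; rewrite EP'; congr <[psiv (flagpar _)]>%VS; apply: funext => k.
  by rewrite /ya mulr1 addrC subrK.
move=> f g fg0.
have E h a : h.@[psiv (flagpar (ya a)) ord0] = h.@[fun k => (c k).[a]].
  by apply: meval_eq => k; rewrite mxE Ec.
have [|f0|g0] := @poly_curve_prime F 15 c f g.
- by move=> a; rewrite -!E; apply: fg0.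
- by left=> a; rewrite E.
by right=> a; rewrite E.
Qed.

Lemma flag_irreducible i : zirreducible (flag i).
Proof.
have [i3|i3] := boolP (i <= 3)%N; first exact: flag_irreducible_small.
have -> : flag i = @secvar F by rewrite /flag (negPf i3).
exact: secvar_irreducible.
Qed.

(** Going down: the block 2 l q_j q_k vanishes, then the columns of t1 and t2, then t0 q2
    (coordinate 5), then t0 q1 (coordinate 1). *)
Definition flag_eqs (i : nat) (f : {mpoly F[15]}) : Prop :=
  [\/ form_on (@secvar F) f,
      (i <= 3)%N /\ exists j a, [/\ (j < 3)%N, (a < 3)%N & f = scrollmx (@Xs F) j a],
      (i <= 2)%N /\ exists j a, [/\ (j < 3)%N, a \in [:: 4; 5]%N & f = scrollmx (@Xs F) j a]
    | ((i <= 1)%N /\ f = Xs F 5) \/ ((i <= 0)%N /\ f = Xs F 1)].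

Lemma meval_scrollmx p j a :
  (scrollmx (@Xs F) j a).@[psiv p ord0] = scrollmx (psi p) j a.
Proof. by rewrite rmorph_scrollmx /scrollmx /= !mevalXU !mxE !inordK. Qed.

Lemma rowpar_eq0 p j a : (j < 3)%N -> p j != 0 ->
  (scrollmx (@Xs F) j a).@[psiv p ord0] = 0 -> rowpar p a = 0.
Proof.
move=> j3 nzj; rewrite meval_scrollmx scrollmx_psi // => /eqP.
by rewrite mulf_eq0 (negPf nzj) => /eqP.
Qed.

Lemma flag_closed i : zclosed (flag i).
Proof.
exists (flag_eqs i); split.
  move=> f [[]//|[_ [j [a [_ _ ->]]]]|[_ [j [a [_ _ ->]]]]|[[_ ->]|[_ ->]]];
  by exists 1%N; rewrite ?scrollmx_homog ?Xs_homog.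
move=> P; split=> [fP f|].
  have XP := flag_secvar fP; case=> [[_ f0]|[i3 H]|[i2 H]|H]; first exact: f0.
  - move: fP; rewrite /flag i3 => -[y [_ EP]]; case: H => j [a [j3 a3 ->]].
    apply/(vanishes_atE (scrollmx_homog _ _ _) EP); rewrite meval_scrollmx scrollmx_psi //.
    by case: a a3 => [|[|[|//]]] _; rewrite /rowpar /= ?(mulr0, mul0r).
  - move: fP; rewrite /flag (leq_trans i2) // => -[y [y0 EP]]; case: H => j [a [j3 a3 ->]].
    apply/(vanishes_atE (scrollmx_homog _ _ _) EP); rewrite meval_scrollmx scrollmx_psi //.
    have y4 : y 4 = 0 by apply: y0; case: i i2 => [|[|[|]]].
    move: a3; rewrite !inE => /orP[] /eqP ->; rewrite /rowpar /flagpar /= y4;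
    by rewrite ?expr0n ?(mulr0, mul0r).
  case: H => -[i1 ->]; move: fP; rewrite /flag (leq_trans i1) // => -[y [y0 EP]];
  apply/(vanishes_atE (Xs_homog _ _) EP); rewrite mevalXU mxE inordK // /psi /flagpar /=.
    have -> : y 2 = 0 by apply: y0; case: i i1 => [|[|]].
    by rewrite mulr0.
  have -> : y 1 = 0 by apply: y0; case: i i1.
  by rewrite mulr0.
move=> H; have XP : secvar P.
  have [S [Sf SX]] := secvar_closed F.
  apply/SX => f Sff; apply: H; constructor 1; split; first exact: Sf.
  by move=> Q /SX; apply.
rewrite /flag; case: ifP => // i3; have [p [hp EP]] := XP.
have [j [a [j3 a6 nzj nza]]] := psiv_neq0 (proj_vec_neq0 EP).
have nz2 : (2 : F) != 0 by rewrite pnatr_eq0.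
have H0 f : flag_eqs i f -> f.@[psiv p ord0] = 0.
  by move/H; apply; rewrite EP memv_line.
have l0 : p 3 = 0.
  have : rowpar p j = 0.
    by apply: (rowpar_eq0 j3 nzj); apply: H0; constructor 2; split=> //; exists j, j.
  have -> : rowpar p j = 2 * p 3 * p j by case: (j) j3 => [|[|[|]]].
  by move/eqP; rewrite !mulf_eq0 (negPf nzj) (negPf nz2) orbF => /eqP.
have t12 : (i <= 2)%N -> p 5 = 0 /\ p 6 = 0.
  move=> i2; have E b : b \in [:: 4; 5]%N -> rowpar p b = 0.
    move=> b45; apply: (rowpar_eq0 j3 nzj); apply: H0; constructor 3.
    by split=> //; exists j, b.
  have /eqP := E 4%N isT; have /= := E 5%N isT; rewrite /rowpar /= => -> .
  by rewrite mulf_eq0 (negPf nz2) => /eqP ->.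
have t0 : (i <= 2)%N -> p 4 != 0.
  move=> /t12[t1 t2]; apply: contra nza => /eqP t0; rewrite /rowpar l0 t0 t1 t2.
  by do 6?[case: a a6 => [|a] a6] => //=; rewrite ?mulr0 ?mul0r.
have q2 : (i <= 1)%N -> p 2 = 0.
  move=> i1; have : (Xs F 5).@[psiv p ord0] = 0 by apply: H0; constructor 4; left.
  rewrite mevalXU mxE inordK // /psi /= => /eqP; rewrite mulf_eq0.
  by rewrite (negPf (t0 _)) ?(leq_trans i1) // => /eqP.
have q1 : (i <= 0)%N -> p 1 = 0.
  move=> i0; have : (Xs F 1).@[psiv p ord0] = 0 by apply: H0; constructor 4; right.
  rewrite mevalXU mxE inordK // /psi /= => /eqP; rewrite mulf_eq0.
  by rewrite (negPf (t0 _)) ?(leq_trans i0) // => /eqP.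
have t112 : p 5 ^+ 2 = p 4 * p 6.
  apply/eqP; rewrite -subr_eq0 -[X in _ == X]hp /hyp l0; apply/eqP; ring.
(* With l = 0 the form t has zero discriminant, hence is the square of x0 X + x1 Y; t0 = 0 needs a
   separate choice of x1. *)
pose x0 := sqrtC (p 4); pose x1 := if p 4 == 0 then sqrtC (p 6) else p 5 / x0.
have x00 : x0 ^+ 2 = p 4 by rewrite sqrtCK.
have Ex : x0 * x1 = p 5 /\ x1 ^+ 2 = p 6.
  rewrite /x1; case: eqP => [t00|/eqP nz4].
    rewrite sqrtCK /x0 t00 sqrtC0 mul0r; split=> //; apply/esym/eqP.
    by rewrite -sqrf_eq0 t112 t00 mul0r.
  have nzx : x0 != 0 by rewrite /x0 sqrtC_eq0.
  split; first by field.
  by rewrite expr_div_n x00 t112; field.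
have [E1 E2] := Ex; exists (fun k => nth 0 [:: p 0; p 1; p 2; x0; x1] k); split; last first.
  rewrite EP; congr <[_]>%VS; apply/rowP => -[k k15]; rewrite !mxE.
  do 15?[case: k k15 => [|k] k15] => //;
  by rewrite /psi /flagpar /= ?x00 ?E1 ?E2 ?l0.
have x10 : (i <= 2)%N -> x1 = 0.
  by move=> i2; apply/eqP; rewrite -sqrf_eq0; case: Ex => _ ->; case: (t12 i2) => _ ->.
rewrite /flag_zeros; case: i {H H0 t12} i3 t0 q2 q1 x10 => [|[|[|[|//]]]] _ t0 q2 q1 x10 k;
rewrite /= ?inE //.
- by case/or3P => /eqP -> /=; [exact: x10 | exact: q2 | exact: q1].
- by case/orP => /eqP -> /=; [exact: x10 | exact: q2].
by move/eqP => -> /=; exact: x10.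
Qed.

Lemma flag_sub i : (i <= 3)%N -> psub (flag i) (flag i.+1).
Proof.
move=> i3 P; have [|i4] := ltnP i 3; last first.
  by move/flag_secvar; rewrite /flag ltnNge i4.
move=> lt; rewrite /flag i3 lt => -[y [y0 EP]]; exists y; split=> // k.
move=> kz; apply: y0; move: kz; rewrite /flag_zeros.
by case: i i3 lt => [|[|[|]]] // _ _; rewrite /= ?inE // => H; repeat case/orP: H => H; rewrite ?H ?orbT.
Qed.

Lemma flag_strict i : (i <= 3)%N -> ~ psub (flag i.+1) (flag i).
Proof.
move=> i3 sub.
(* The coordinates t0 q1, t0 q2, t2 q0 and 2 l q0^2: each vanishes on [flag i] but not on
   [flag i.+1]. *)
pose k := nth 0%N [:: 1; 5; 12; 2]%N i.
have k15 : (k < 15)%N by rewrite /k; case: i i3 {sub k} => [|[|[|[|]]]].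
have small y : (forall k, k \in flag_zeros i -> y k = 0) -> psi (flagpar y) k = 0.
  move=> y0; rewrite /psi /flagpar /k /=.
  case: i i3 y0 {sub k k15} => [|[|[|[|//]]]] _ y0 /=.
  - by rewrite (y0 1%N) ?mulr0.
  - by rewrite (y0 2%N) ?mulr0.
  - by rewrite (y0 4%N) ?expr0n ?mul0r.
  by rewrite mulr0 mul0r.
have [P [XP nz]] : exists P, flag i.+1 P /\ exists p, val P = <[psiv p]>%VS /\ psi p k != 0.
  have mk p : psi p k != 0 -> exists P : proj F 14, val P = <[psiv p]>%VS.
    move=> nz; apply: proj_of_vec; apply: contra nz => /eqP/rowP/(_ (Ordinal k15)).
    by rewrite !mxE => ->.
  have [i2|i2] := leqP i 2.
    pose y (j : nat) : F := nth 0 (nth [::] [:: [:: 0; 1; 0; 1; 0]; [:: 0; 0; 1; 1; 0];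
      [:: 1; 0; 0; 0; 1]] i) j.
    have nz : psi (flagpar y) k != 0.
      rewrite /psi /flagpar /k /y; case: i i3 i2 {sub k k15 small mk y} => [|[|[|//]]] _ _ /=;
      by rewrite expr1n mulr1 oner_eq0.
    have [P EP] := mk _ nz; exists P; split; last by exists (flagpar y).
    rewrite /flag ltnS i2; exists y; split=> // j.
    rewrite /y /flag_zeros; case: i i3 i2 {sub k k15 small mk y nz EP} => [|[|[|//]]] _ _ /=;
    by rewrite /= ?inE // => H; repeat case/orP: H => H; move/eqP: H => ->.
  have i_3 : i = 3%N by apply/eqP; rewrite eqn_leq i3.
  have [p [hp nz _]] := secvar_witness F.
  have nzk : psi p k != 0 by rewrite /k i_3.
  have [P EP] := mk _ nzk; exists P; split; last by exists p.
  by rewrite /flag i_3 /=; exists p.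
case: nz => p [EP]; apply/negP/negPn; have := sub P XP.
rewrite /flag i3 => -[y [y0 EP']].
have : psiv p \in <[psiv (flagpar y)]>%VS by rewrite -EP' EP memv_line.
case/vlineP => a /rowP/(_ (Ordinal k15)); rewrite !mxE /= => ->.
by rewrite small // mulr0.
Qed.

Lemma secvar_has_dim : has_dim (@secvar F) 4.
Proof.
split; last exact: secvar_chain_length.
exists flag; split=> [i _|i i4]; last by split; [apply: flag_sub | apply: flag_strict].
by split; [apply: flag_closed | apply: flag_irreducible | move=> P; apply: flag_secvar].
Qed.

End Flag.

(** * Restriction of forms to a line *)

Lemma span2P (F : fieldType) (V : vectType F) (A B v : V) :
  v \in <<[:: A; B]>>%VS <-> exists a b, v = a *: A + b *: B.
Proof.
rewrite span_cons span_seq1; split.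
  by case/memv_addP => _ /vlineP[a ->] [_ /vlineP[b ->] ->]; exists a, b.
by case=> a [b ->]; rewrite memv_add // memvZ ?memv_line.
Qed.

Lemma span2_sub (F : fieldType) (V : vectType F) (A B : V) (W : {vspace V}) :
  A \in W -> B \in W -> (<<[:: A; B]>> <= W)%VS.
Proof. by move=> AW BW; rewrite span_cons span_seq1 subv_add -!memvE AW. Qed.

Lemma vanishing_form0 (F : fieldType) n (X : proj F n -> Prop) f P : X P ->
  (forall P, X P -> vanishes_at f P) -> f.@[fun=> 0] = 0.
Proof.
move=> XP /(_ P XP 0 (mem0v _)) E; rewrite -[RHS]E.
by apply: meval_eq => k; rewrite mxE.
Qed.

Section Line.
Variables (F : numFieldType) (n : nat) (A B : 'rV[F]_n.+1).
Implicit Types (f g : {mpoly F[n.+1]}).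

Definition linepar (k : 'I_n.+1) : {poly F} := (A ord0 k)%:P + B ord0 k *: 'X.

(** A binary form, dehomogenized along A + s B: B is the point at infinity, and for f of degree d
    the coefficient of s^d is the value at B. *)
Definition restr f : {poly F} := mmap polyC linepar f.

Lemma restr_horner f a : (restr f).[a] = f.@[(A + a *: B) ord0].
Proof.
rewrite /restr mmap_hornerE; apply: meval_eq => k.
by rewrite /linepar !hornerE !mxE mulrC.
Qed.

Lemma size_restr f d : f \is d.-homog -> (size (restr f) <= d.+1)%N.
Proof.
move=> /dhomogP fd; rewrite /restr /mmap; apply: leq_trans (size_sum _ _ _) _.
apply/bigmax_leqP_seq => k kf _; rewrite mul_polyC.
apply: leq_trans (size_scale_leq _ _) _; have <- : mdeg k = d := fd k kf.
rewrite /mmap1 mdegE.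
have szM (p q : {poly F}) a b : (size p <= a.+1)%N -> (size q <= b.+1)%N ->
    (size (p * q)%R <= (a + b).+1)%N.
  move=> pa qb; apply: leq_trans (size_polyMleq _ _) _.
  by rewrite -subn1 leq_subLR (leq_trans (leq_add pa qb)) // addSn addnS add1n.
apply: (big_ind2 (fun (p : {poly F}) a => (size p <= a.+1)%N)).
- by rewrite size_poly1.
- by move=> p a q b; apply: szM.
move=> i _; elim: (k i) => [|j IH]; first by rewrite expr0 size_poly1.
rewrite exprS; apply: (szM _ _ 1%N j) IH; rewrite /linepar.
apply: leq_trans (size_polyD _ _) _; rewrite geq_max.
rewrite (leq_trans (size_polyC_leq1 _)) //=.
by apply: leq_trans (size_scale_leq _ _) _; rewrite size_polyX.
Qed.

Lemma restrM f g : restr (f * g) = restr f * restr g.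
Proof. exact: rmorphM. Qed.

Lemma restr_linear d : linear (fun f : dhomog n.+1 F d => restr (mpoly_of_dhomog f)).
Proof.
by move=> a f g; rewrite /restr linearP /= mmapD mmapZ mul_polyC.
Qed.

(** For a <> 0 rescaling leads to a point A + s B; multiples of B follow because a polynomial in a
    that is zero off 0 is zero. *)
Lemma restr_vanish f d : f \is d.-homog -> restr f = 0 ->
  forall a b, f.@[(a *: A + b *: B) ord0] = 0.
Proof.
move=> fd f0 a b; pose c (k : 'I_n.+1) : {poly F} := A ord0 k *: 'X + (b * B ord0 k)%:P.
have Ec x : (mmap polyC c f).[x] = f.@[(x *: A + b *: B) ord0].
  rewrite mmap_hornerE; apply: meval_eq => k.
  by rewrite /c !hornerE !mxE mulrC.
have cX : mmap polyC c f * 'X = 0.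
  apply: poly_zero_fun => x; rewrite hornerMX Ec.
  have [->|nzx] := eqVneq x 0; first by rewrite mulr0.
  have -> : f.@[(x *: A + b *: B) ord0] = x ^+ d * f.@[(A + (b / x) *: B) ord0].
    rewrite -(meval_homogZ _ _ fd); apply: meval_eq => k.
    by rewrite !mxE mulrDr mulrA [b / x]mulrC mulrA mulfV // mul1r.
  by rewrite -restr_horner f0 horner0 mulr0 mul0r.
move/eqP: cX; rewrite mulf_eq0 polyX_eq0 orbF => /eqP c0.
by rewrite -Ec c0 horner0.
Qed.

Hypothesis AB_free : free [:: A; B].

Lemma dual_form (i : 'I_2) :
  exists2 f : {mpoly F[n.+1]}, f \is 1.-homog & restr f = 'X ^+ i.
Proof.
pose X := [tuple A; B]; pose phi (v : 'rV[F]_n.+1) : F := coord X i v.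
pose f : {mpoly F[n.+1]} := \sum_k phi (delta_mx ord0 k) *: 'X_k.
have fv (v : 'rV[F]_n.+1) : \sum_k phi (delta_mx ord0 k) * v ord0 k = phi v.
  rewrite [in RHS](row_sum_delta v) /phi linear_sum /=; apply: eq_bigr => k _.
  by rewrite linearZ /= mulrC.
exists f.
  by rewrite rpred_sum // => k _; rewrite rpredZ // dhomogX /= mdeg1.
rewrite /restr /f raddf_sum /=; transitivity ((phi A)%:P + phi B *: 'X).
  rewrite -!fv raddf_sum scaler_suml -big_split /=; apply: eq_bigr => k _.
  by rewrite mmapZ mmapX mmap1U /linepar mulrDr -polyCM mul_polyC scalerA.
have -> : phi A = (ord0 == i)%:R := coord_free ord0 i AB_free.
have -> : phi B = (ord_max == i)%:R := coord_free ord_max i AB_free.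
case: i {phi f fv} => -[|[|//]] ?; rewrite /= ?scale0r ?scale1r ?addr0 ?expr0 //.
by rewrite polyC0 add0r expr1.
Qed.

(** With linear forms restricting to 1 and s, products of their powers of total degree d restrict to
    1, s, ..., s^d. *)
Lemma restr_surj d (a : {poly F}) : (size a <= d.+1)%N ->
  exists2 f : {mpoly F[n.+1]}, f \is d.-homog & restr f = a.
Proof.
move=> sa; have [al ah Ea] := dual_form ord0; have [be bh Eb] := dual_form ord_max.
exists (\sum_(k < d.+1) a`_k *: (al ^+ (d - k) * be ^+ k)).
  rewrite rpred_sum // => k _; rewrite rpredZ //.
  suff : al ^+ (d - k) * be ^+ k \is (d - k + k).-homog by rewrite subnK // -ltnS.
  apply: dhomogM; first by have := dhomogMn (d - k) ah; rewrite mul1n.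
  by have := dhomogMn k bh; rewrite mul1n.
rewrite /restr raddf_sum /= -[in RHS](coefK a).
rewrite [RHS](_ : _ = \sum_(k < d.+1) a`_k *: 'X^k); last first.
  rewrite poly_def; rewrite (big_ord_widen _ (fun i => a`_i *: 'X^i) sa) big_mkcond /=.
  by apply: eq_bigr => k _; case: ltnP => // ak; rewrite nth_default // scale0r.
apply: eq_bigr => k _; rewrite mmapZ mul_polyC rmorphM !rmorphXn /=.
by rewrite -/(restr al) -/(restr be) Ea Eb expr0 expr1n mul1r.
Qed.

End Line.

Section RestrictionMap.
Variables (F : numFieldType) (n : nat) (A B : 'rV[F]_n.+1) (d : nat).

Definition restrL (f : dhomog n.+1 F d) : 'rV[F]_d.+1 :=
  poly_rV (restr A B (mpoly_of_dhomog f)).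

Fact restrL_is_linear : linear restrL.
Proof. by move=> a f g; rewrite /restrL restr_linear linearP. Qed.

HB.instance Definition _ :=
  GRing.isLinear.Build F (dhomog n.+1 F d) 'rV[F]_d.+1 _ restrL restrL_is_linear.

Variable g : {poly F}.

(** For g of degree 2, the restriction to the scheme g = 0 on the line, with F[s]/(g) identified
    with F^2. *)
Definition restr_modL (f : dhomog n.+1 F d) : 'rV[F]_2 :=
  poly_rV (restr A B (mpoly_of_dhomog f) %% g).

Fact restr_modL_is_linear : linear restr_modL.
Proof.
by move=> a f f'; rewrite /restr_modL restr_linear modpD modpZl linearP.
Qed.

HB.instance Definition _ :=
  GRing.isLinear.Build F (dhomog n.+1 F d) 'rV[F]_2 _ restr_modL restr_modL_is_linear.

Lemma rVpoly_restrL f : rVpoly (restrL f) = restr A B (mpoly_of_dhomog f).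
Proof. by rewrite poly_rV_K // size_restr // dhomog_is_dhomog. Qed.

Hypothesis AB_free : free [:: A; B].

Lemma restrL_full : limg (linfun restrL) = fullv.
Proof.
apply/vspaceP => v; rewrite memvf; apply/memv_imgP.
have [f fd Ef] := restr_surj AB_free (size_poly d.+1 _ : (size (rVpoly v) <= d.+1)%N).
exists (DHomog fd); rewrite ?memvf // lfunE /= /restrL /= Ef.
by rewrite rVpolyK.
Qed.

Lemma restr_modL_full : (0 < d)%N -> size g = 3%N -> limg (linfun restr_modL) = fullv.
Proof.
move=> d0 sg; apply/vspaceP => v; rewrite memvf; apply/memv_imgP.
have sv : (size (rVpoly v) <= 2)%N := size_poly 2 _.
have [|f fd Ef] := @restr_surj F n A B AB_free d (rVpoly v).
  by apply: leq_trans sv _.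
exists (DHomog fd); rewrite ?memvf // lfunE /= /restr_modL /= Ef modp_small.
  by rewrite rVpolyK.
by rewrite sg.
Qed.

End RestrictionMap.

Section Multiplication.
Variables (F : fieldType) (p : {poly F}) (e : nat).

Definition mulpL (a : 'rV[F]_e.+1) : 'rV[F]_e.+3 := poly_rV (p * rVpoly a).

Fact mulpL_is_linear : linear mulpL.
Proof.
move=> x a b; rewrite /mulpL linearP mulrDr -scalerAr.
by rewrite linearP.
Qed.

HB.instance Definition _ :=
  GRing.isLinear.Build F 'rV[F]_e.+1 'rV[F]_e.+3 _ mulpL mulpL_is_linear.

Lemma rVpoly_mulpL a : (size p <= 3)%N -> rVpoly (mulpL a) = p * rVpoly a.
Proof.
move=> sp; rewrite poly_rV_K //; apply: leq_trans (size_polyMleq _ _) _.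
rewrite -subn1 leq_subLR add1n.
by apply: leq_trans (leq_add sp (size_poly _ _ : (size (rVpoly a) <= e.+1)%N)) _.
Qed.

Lemma lker_mulpL : p != 0 -> (size p <= 3)%N -> lker (linfun mulpL) = 0%VS.
Proof.
move=> nzp sp; apply/eqP; rewrite -subv0; apply/subvP => a.
rewrite memv_ker memv0 lfunE /= => /eqP a0.
have := rVpoly_mulpL a sp; rewrite a0 linear0 => /esym/eqP.
by rewrite mulf_eq0 (negPf nzp) /= -{2}[a]rVpolyK => /eqP ->; rewrite linear0.
Qed.

End Multiplication.

(** * Length 2 subschemes and forms on a line *)

Section ChordCriterion.
Variables (F : numFieldType) (n : nat) (X : proj F n -> Prop) (l : pline F n).
Variables (A B : 'rV[F]_n.+1).
Hypothesis lAB : val l = <<[:: A; B]>>%VS.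

Lemma line_free : free [:: A; B].
Proof. by rewrite /free -lAB; apply: (svalP l). Qed.

Lemma on_line_form f d : f \is d.-homog -> restr A B f = 0 -> form_on (on_line l) f.
Proof.
move=> fd f0; split=> [|P Pl v vP]; first by exists d.
have : v \in val l by apply: (subvP Pl).
rewrite lAB => /span2P[a [b ->]]; exact: restr_vanish fd f0 a b.
Qed.

(* In degree e + 2 the ideal has codimension 2 on binary forms, so it already
   coincides there with the multiples of the first quadratic form p1. *)
Lemma chord_restr_proportional f1 f2 :
    is_chord X l -> f1 \is 2.-homog -> f2 \is 2.-homog ->
    form_on X f1 -> form_on X f2 -> restr A B f1 != 0 ->
  exists c, restr A B f2 = c *: restr A B f1.
Proof.
case=> K [[K0 KD KM _] Kl KX [e Ke]] f1h f2h f1X f2X nz1.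
have AB_free := line_free; set p1 := restr A B f1 in nz1 *.
have [U [memU dimU]] := Ke e.+2 (leqW (leqnSn e)).
pose rho := linfun (@restrL F n A B e.+2).
have kerU : (lker rho <= U)%VS.
  apply/subvP => f; rewrite memv_ker lfunE /= => /eqP f0; apply/memU/Kl.
  apply: (on_line_form (dhomog_is_dhomog f)).
  by rewrite -rVpoly_restrL f0 linear0.
(* [rho] is onto the binary forms of degree e + 2 and its kernel lies in U, so codimension 2 passes
   to the image. *)
have dimrU : (\dim (rho @: U) + 2 = e.+3)%N.
  have := limg_ker_dim rho U; rewrite (capv_idPr kerU).
  have := limg_ker_dim rho fullv; rewrite capfv restrL_full // [\dim {: 'rV__}]dimvf /dim /= mul1n.
  by rewrite -dimU => /eqP E1 E2; move: E1; rewrite -E2 -addnA eqn_add2l => /eqP.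
have s1 : (size p1 <= 3)%N by apply: size_restr.
have f_restr f : f \in U -> restrL A B f \in (rho @: U)%VS.
  by move=> fU; apply/memv_imgP; exists f; rewrite // lfunE.
have mulU (a : {poly F}) f (fh : f \is 2.-homog) : form_on X f ->
    (size a <= e.+1)%N -> poly_rV (restr A B f * a) \in (rho @: U)%VS.
  move=> fX sa; have [h hh Eh] := restr_surj AB_free sa.
  have hfh : h * f \is e.+2.-homog by rewrite -addn2; apply: dhomogM.
  have <- : restrL A B (DHomog hfh) = poly_rV (restr A B f * a).
    by rewrite /restrL /= restrM Eh mulrC.
  by apply/f_restr/memU => /=; apply/KM/KX.
pose mu := linfun (@mulpL F p1 e).
have imu : limg mu = (rho @: U)%VS.
  apply/eqP; rewrite eqEdim; apply/andP; split.
    apply/subvP => _ /memv_imgP[a _ ->]; rewrite lfunE /=.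
    by apply: mulU => //; apply: size_poly.
  have := limg_ker_dim mu fullv; rewrite capfv lker_mulpL // dimv0 add0n => ->.
  by rewrite dimvf /dim /= mul1n; move: dimrU; rewrite addn2 => -[->].
have divp1 (a : {poly F}) : (size a <= e.+1)%N ->
    exists2 b : {poly F}, (size b <= e.+1)%N & restr A B f2 * a = p1 * b.
  move=> sa; have := mulU a f2 f2h f2X sa; rewrite -imu => /memv_imgP[b _].
  rewrite lfunE /= => /(congr1 rVpoly); rewrite rVpoly_mulpL // poly_rV_K.
    by move=> ->; exists (rVpoly b) => //; apply: size_poly.
  apply: leq_trans (size_polyMleq _ _) _; rewrite -subn1 leq_subLR add1n.
  by apply: leq_trans (leq_add (size_restr _ _ f2h) sa) _.
(* The degree of p1 may drop when it vanishes at B. The multiplier 1 gives p2 = a p1 for the second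
   quadratic form p2, and the multiplier s^e bounds the size of a s^e by e + 1, which forces a to be
   constant. *)
have [|a sa Ea] := divp1 1; first by rewrite size_poly1.
have [|b sb Eb] := divp1 'X^e; first by rewrite size_polyXn.
exists a`_0; rewrite mulr1 in Ea; rewrite Ea mulrC -mul_polyC; congr (_ * _).
apply: size1_polyC; have [->|nza] := eqVneq a 0; first by rewrite size_poly0.
move: Eb; rewrite Ea -mulrA => /(mulfI nz1) Eb; move: sb; rewrite -Eb.
by rewrite size_mulXn // -addn1 leq_add2l.
Qed.

Lemma is_chord_of_modulus (g : {poly F}) : size g = 3%N ->
  (forall f, form_on X f -> g %| restr A B f) -> is_chord X l.
Proof.
move=> sg gX; have AB_free := line_free.
have nzg : g != 0 by rewrite -size_poly_eq0 sg.
(* Restriction along c (A + s B). Requiring divisibility for every c makes the ideal homogeneous,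
   since powers of c separate the parts of different degrees. *)
pose ev c f := mmap polyC (fun k => c%:P * linepar A B k) f.
have evM c f h : ev c (f * h) = ev c f * ev c h by apply: rmorphM.
have evh c f d : f \is d.-homog -> ev c f = c ^+ d *: restr A B f.
  by move=> fd; rewrite /ev (mmap_homogZ _ _ _ fd) -polyC_exp mul_polyC.
have ev1 f : ev 1 f = restr A B f.
  by apply: eq_mmap => // k; rewrite mul1r.
exists (fun f => forall c, g %| ev c f); split.
- split=> [c|f h Kf Kh c|f h Kh c|d f Kf c].
  + by rewrite /ev mmap0 dvdp0.
  + by rewrite /ev mmapD dvdp_add ?Kf ?Kh.
  + by rewrite evM dvdp_mull.
  rewrite (evh c _ d) ?pihomogP // -mul_polyC dvdp_mull //.
  pose k := maxn (msize f) d.+1; pose fh j := pihomog mdeg j f.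
  pose r j := restr A B (fh j) %% g.
  have r0 x : \sum_(j < k) x ^+ j *: r j = 0.
    have := Kf x; rewrite (pihomog_partitionE (leq_maxl _ _ : (msize f <= k)%N)).
    rewrite /dvdp /ev raddf_sum /= => /eqP E; rewrite -[RHS]E.
    rewrite (big_morph _ (modpD g) (mod0p g)); apply: eq_bigr => j _.
    by rewrite /= -/(ev x _) (evh x _ j) ?pihomogP // modpZl.
  have rd : r d = 0.
    apply/polyP => i; rewrite coef0.
    have : \poly_(j < k) (r j)`_i = 0.
      apply: poly_zero_fun => x; rewrite horner_poly -[RHS](coef0 _ i) -(r0 x).
      by rewrite coef_sum; apply: eq_bigr => j _; rewrite coefZ mulrC.
    by move/polyP/(_ d); rewrite coef_poly coef0 leq_maxr.
  by rewrite /dvdp -/(r d) rd.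
- move=> f [ff f0] c.
  suff -> : ev c f = 0 by rewrite dvdp0.
  apply: poly_zero_fun => x; rewrite mmap_hornerE.
  have Ev : f.@[fun k => (c%:P * linepar A B k).[x]] = f.@[(c *: A + (c * x) *: B) ord0].
    by apply: meval_eq => k; rewrite /linepar !hornerE !mxE; ring.
  rewrite Ev; set v := _ + _.
  have vl : v \in val l by rewrite lAB; apply/span2P; exists c, (c * x).
  have [P Pl] : exists P, on_line l P.
    have nzA : A != 0 by have := free_not0 AB_free (mem_head _ _).
    have [P EP] := proj_of_vec nzA; exists P; rewrite /on_line EP -memvE lAB.
    by apply/span2P; exists 1, 0; rewrite scale1r scale0r addr0.
  have [v0|nzv] := eqVneq v 0.
    have := vanishing_form0 Pl f0 => E; rewrite -[RHS]E.
    by apply: meval_eq => k; rewrite v0 mxE.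
  have [Q EQ] := proj_of_vec nzv; apply: (f0 Q); last by rewrite EQ memv_line.
  by rewrite /on_line EQ -memvE.
- move=> f fX c; have [[d fd] _] := fX.
  by rewrite (evh c _ d) // -mul_polyC dvdp_mull // gX.
(* From degree 1 on, restriction modulo g is onto a space of dimension 2. *)
exists 1%N => d d0; exists (lker (linfun (@restr_modL F n A B d g))); split.
  move=> f; rewrite memv_ker lfunE /=.
  have sz : (size (restr A B (mpoly_of_dhomog f) %% g)%R <= 2)%N.
    by rewrite -ltnS -sg ltn_modp.
  split=> [/eqP f0 c|Kf].
    rewrite (evh c _ d) ?dhomog_is_dhomog // -mul_polyC dvdp_mull //.
    by rewrite /dvdp -(poly_rV_K sz) -/(restr_modL A B g f) f0 linear0.
  have := Kf 1; rewrite ev1 /dvdp => /eqP E.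
  by rewrite /restr_modL E linear0.
have := limg_ker_dim (linfun (@restr_modL F n A B d g)) fullv.
by rewrite capfv restr_modL_full // [\dim {: 'rV__}]dimvf /dim /= mul1n.
Qed.

End ChordCriterion.

(** * Chords of the scroll *)

Section ScrollQuadrics.
Variable S : comNzRingType.
Implicit Types z : nat -> S.

(** The scroll is the locus where the 2 x 4 matrix with rows [toprow] and [botrow] has rank 1;
    [squad] gives its minors. *)
Definition toprow z (a : nat) : S := nth 0 [:: z 0; z 1; z 3; z 4] a.
Definition botrow z (a : nat) : S := nth 0 [:: z 1; z 2; z 4; z 5] a.

Definition squad z (a b : nat) : S :=
  toprow z a * botrow z b - toprow z b * botrow z a.

(** The polar form of [squad]: the coefficient of s in its value at z + s w. *)
Definition spolar z w (a b : nat) : S :=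
  toprow z a * botrow w b + toprow w a * botrow z b
  - toprow z b * botrow w a - toprow w b * botrow z a.

Definition scroll (x0 x1 y0 y1 : S) (k : nat) : S :=
  nth 0 [:: x0 * y0 ^+ 2; x0 * (y0 * y1); x0 * y1 ^+ 2;
            x1 * y0 ^+ 2; x1 * (y0 * y1); x1 * y1 ^+ 2] k.

(** Derivative of [scroll] at (x, y) in the direction (x', z). *)
Definition scroll_tan (x0 x1 y0 y1 x0' x1' z0 z1 : S) (k : nat) : S :=
  scroll x0' x1' y0 y1 k +
  nth 0 [:: x0 * (2 * y0 * z0); x0 * (y0 * z1 + y1 * z0); x0 * (2 * y1 * z1);
            x1 * (2 * y0 * z0); x1 * (y0 * z1 + y1 * z0); x1 * (2 * y1 * z1)] k.

Lemma squad_scroll x0 x1 y0 y1 a b : squad (scroll x0 x1 y0 y1) a b = 0.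
Proof.
do 4?[case: a => [|a]]; do 4?[case: b => [|b]];
by rewrite /squad /toprow /botrow /scroll /= ?nth_nil; ring.
Qed.

Definition wedgef z w (k : nat) : S :=
  let m i j := z i * w j - z j * w i in
  nth 0 [:: m 0 1; m 0 2; m 0 3; m 0 4; m 0 5; m 1 2; m 1 3; m 1 4; m 1 5;
            m 2 3; m 2 4; m 2 5; m 3 4; m 3 5; m 4 5]%N k.

End ScrollQuadrics.

Section Secants.
Variable F : numFieldType.

Definition secpar (x0 x1 y0 y1 x0' x1' y0' y1' : F) (i : nat) : F :=
  let d := y0 * y1' - y1 * y0' in
  nth 0 [:: y0 * y0'; y0 * y1' + y1 * y0'; y1 * y1';
    (x0 * x1' - x1 * x0') / 2; d * (x0 * x0'); d * (x0 * x1' + x1 * x0') / 2;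
    d * (x1 * x1')] i.

(** Limit of [secpar] when the second point is (x + s x', y + s z) and l, t are divided by s: q =
    y^2, l = [x, x'] / 2, t = [y, z] x^2. *)
Definition tanpar (x0 x1 y0 y1 x0' x1' z0 z1 : F) (i : nat) : F :=
  let d := y0 * z1 - y1 * z0 in
  nth 0 [:: y0 ^+ 2; 2 * y0 * y1; y1 ^+ 2; (x0 * x1' - x1 * x0') / 2;
    d * x0 ^+ 2; d * (x0 * x1); d * x1 ^+ 2] i.

Lemma wedge_secant x0 x1 y0 y1 x0' x1' y0' y1' k : (k < 15)%N ->
  wedgef (scroll x0 x1 y0 y1) (scroll x0' x1' y0' y1') k =
  psi (secpar x0 x1 y0 y1 x0' x1' y0' y1') k.
Proof.
do 15?[case: k => [|k]] => //;
by rewrite /wedgef /scroll /psi /secpar /= => _; field.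
Qed.

Lemma wedge_tangent x0 x1 y0 y1 x0' x1' z0 z1 k : (k < 15)%N ->
  wedgef (scroll x0 x1 y0 y1) (scroll_tan x0 x1 y0 y1 x0' x1' z0 z1) k =
  psi (tanpar x0 x1 y0 y1 x0' x1' z0 z1) k.
Proof.
do 15?[case: k => [|k]] => //;
by rewrite /wedgef /scroll_tan /scroll /psi /tanpar /= => _; field.
Qed.

Lemma hyp_secpar x0 x1 y0 y1 x0' x1' y0' y1' :
  hyp (secpar x0 x1 y0 y1 x0' x1' y0' y1') = 0.
Proof. by rewrite /hyp /secpar /=; field. Qed.

Lemma hyp_tanpar x0 x1 y0 y1 x0' x1' z0 z1 :
  hyp (tanpar x0 x1 y0 y1 x0' x1' z0 z1) = 0.
Proof. by rewrite /hyp /tanpar /=; field. Qed.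

(** If z 0 or z 3 is nonzero, the ratio of the two rows gives y with y0 = 1; otherwise the minors
    kill z 1 and z 4 and y = (0, 1). *)
Lemma squad0_scroll (z : nat -> F) : (forall a b, squad z a b = 0) ->
    (exists2 k, (k < 6)%N & z k != 0) ->
  exists x0 x1 y0 y1, [/\ (x0 != 0) || (x1 != 0), (y0 != 0) || (y1 != 0)
    & forall k, (k < 6)%N -> z k = scroll x0 x1 y0 y1 k].
Proof.
move=> q0 [k0 k6 nzk].
have E a b : toprow z a * botrow z b = toprow z b * botrow z a.
  by apply/eqP; rewrite -subr_eq0; apply/eqP/q0.
have E01 := E 0 1; have E02 := E 0 2; have E03 := E 0 3.
have E12 := E 1 2; have E13 := E 1 3; have E23 := E 2 3.
rewrite /toprow /botrow /= in E01 E02 E03 E12 E13 E23.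
have [z00|nz0] := eqVneq (z 0) 0; last first.
  exists (z 0), (z 3), 1, (z 1 / z 0); split; rewrite ?nz0 ?oner_eq0 //.
  move=> k; do 6?[case: k => [|k]] => //= _; rewrite /scroll /=; apply: (mulfI nz0).
  - by field.
  - by field.
  - by rewrite E01; field.
  - by field.
  - by rewrite E02; field.
  - by rewrite E03; apply: (mulfI nz0); rewrite [LHS]mulrA E02; field.
have [z30|nz3] := eqVneq (z 3) 0; last first.
  exists (z 0), (z 3), 1, (z 4 / z 3); split; rewrite ?nz3 ?orbT ?oner_eq0 //.
  move: E01 E02 E03; rewrite z00 !mul0r => /esym/eqP; rewrite mulf_eq0 orbb => /eqP z10.
  move=> _ _; rewrite z10 ?mul0r in E12 E13 *.
  move/esym/eqP: E12; rewrite mulf_eq0 (negPf nz3) /= => /eqP z20.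
  move=> k; do 6?[case: k => [|k]] => //= _; rewrite /scroll /= ?z00 ?z10 ?z20 ?mul0r //.
  - by rewrite expr1n mulr1.
  - by field.
  by apply: (mulfI nz3); rewrite E23; field.
have z10 : z 1 = 0.
  by move/esym/eqP: E01; rewrite z00 mul0r mulf_eq0 orbb => /eqP.
have z40 : z 4 = 0.
  by move/esym/eqP: E23; rewrite z30 mul0r mulf_eq0 orbb => /eqP.
exists (z 2), (z 5), 0, 1; split; rewrite ?oner_eq0 ?orbT //.
  apply: contraNT nzk; rewrite negb_or !negbK => /andP[/eqP z2 /eqP z5].
  by do 6?[case: k0 k6 => [|k0] k6] => //; rewrite ?z00 ?z10 ?z2 ?z30 ?z40 ?z5.
by move=> k; do 6?[case: k => [|k]] => //= _; rewrite /scroll /=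
  ?z00 ?z10 ?z30 ?z40; ring.
Qed.

(** The linearized quadrics leave exactly the tangent directions of the scroll. *)
Lemma spolar0_tangent x0 x1 y0 y1 (w : nat -> F) :
    (x0 != 0) || (x1 != 0) -> (y0 != 0) || (y1 != 0) ->
    (forall a b, spolar (scroll x0 x1 y0 y1) w a b = 0) ->
  exists x0' x1' z0 z1,
    forall k, (k < 6)%N -> w k = scroll_tan x0 x1 y0 y1 x0' x1' z0 z1 k.
Proof.
move=> nzx nzy P0.
have P01 := P0 0 1; have P02 := P0 0 2; have P03 := P0 0 3.
have P12 := P0 1 2; have P13 := P0 1 3; have P23 := P0 2 3.
rewrite /spolar /toprow /botrow /scroll /= in P01 P02 P03 P12 P13 P23.
have [y00|nzy0] := eqVneq y0 0.
  move: nzy; rewrite y00 eqxx /= => nzy1.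
  have nzy2 : y1 ^+ 2 != 0 by rewrite expf_neq0.
  have {P01} e0 : w 0 * x0 = 0.
    by apply: (mulIf nzy2); rewrite mul0r -[RHS]P01 y00; ring.
  have {P03} e1 : w 0 * x1 = 0.
    by apply: (mulIf nzy2); rewrite mul0r -[RHS]P03 y00; ring.
  have {P12} e2 : w 3 * x0 = 0.
    by apply: (mulIf nzy2); rewrite mul0r; apply: oppr_inj; rewrite oppr0 -[RHS]P12 y00; ring.
  have {P23} e3 : w 3 * x1 = 0.
    by apply: (mulIf nzy2); rewrite mul0r -[RHS]P23 y00; ring.
  have {P13} e4 : w 1 * x1 = w 4 * x0.
    apply: (mulIf nzy2); apply/eqP; rewrite -subr_eq0 -[X in _ == X]P13 y00; apply/eqP; ring.
  have w0 : w 0 = 0.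
    by case/orP: nzx => nz; apply: (mulIf nz); rewrite mul0r ?e0 ?e1.
  have w3 : w 3 = 0.
    by case/orP: nzx => nz; apply: (mulIf nz); rewrite mul0r ?e2 ?e3.
  have [c [c1 c4]] : exists c, w 1 = c * x0 /\ w 4 = c * x1.
    case/orP: nzx => nz.
      exists (w 1 / x0); split; first by field.
      by apply: (mulIf nz); rewrite -e4; field.
    exists (w 4 / x1); split; last by field.
    by apply: (mulIf nz); rewrite e4; field.
  exists (w 2 / y1 ^+ 2), (w 5 / y1 ^+ 2), (c / y1), 0 => k.
  do 6?[case: k => [|k]] => // _; rewrite /scroll_tan /scroll /= ?w0 ?w3 ?c1 ?c4 ?y00;
  by field.
have nzy2 : y0 ^+ 2 != 0 by rewrite expf_neq0.
pose T a := toprow (scroll x0 x1 y0 y1) a.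
(* D measures how far w is from satisfying y0 [botrow] = y1 [toprow]; the polar equations make it a
   multiple c of the top row T, and w 1, w 2, w 4, w 5 are then determined by w 0, w 3 and c. *)
pose D a := y0 * botrow w a - y1 * toprow w a.
have TD a b : T a * D b = T b * D a.
  have := P0 a b; rewrite /spolar -!/(T _) => E.
  have B c : y0 * botrow (scroll x0 x1 y0 y1) c = y1 * T c.
    do 4?[case: c => [|c]]; rewrite /T /toprow /botrow /scroll /= ?nth_nil; ring.
  apply/eqP; rewrite -subr_eq0; apply/eqP; rewrite -[RHS](mulr0 y0) -[in RHS]E /D.
  transitivity (y0 * T a * botrow w b - y0 * T b * botrow w a - toprow w b * (y1 * T a) + toprow w a * (y1 * T b)).
    by ring.
  by rewrite -!B; ring.
have [c Dc] : exists c, forall a, (a < 4)%N -> D a = c * T a.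
  have [a0 nzT] : exists a0, T a0 != 0.
    by case/orP: nzx => nz; [exists 0%N | exists 2%N]; rewrite /T /toprow /scroll /= mulf_neq0.
  by exists (D a0 / T a0) => a _; apply: (mulfI nzT); rewrite TD; field.
have D0 := Dc 0 isT; have D1 := Dc 1 isT; have D2 := Dc 2 isT; have D3 := Dc 3 isT.
rewrite /D /T /toprow /botrow /scroll /= in D0 D1 D2 D3.
have w1 : w 1 = (c * (x0 * y0 ^+ 2) + y1 * w 0) / y0.
  by rewrite -D0; field.
have w2 : w 2 = (c * (x0 * (y0 * y1)) + y1 * w 1) / y0.
  by rewrite -D1; field.
have w4 : w 4 = (c * (x1 * y0 ^+ 2) + y1 * w 3) / y0.
  by rewrite -D2; field.
have w5 : w 5 = (c * (x1 * (y0 * y1)) + y1 * w 4) / y0.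
  by rewrite -D3; field.
exists (w 0 / y0 ^+ 2), (w 3 / y0 ^+ 2), 0, c => k.
do 6?[case: k => [|k]] => // _; rewrite /scroll_tan /scroll /= ?w5 ?w2 ?w4 ?w1;
by field.
Qed.

End Secants.

Section ScrollPoints.
Variable F : numFieldType.
Implicit Types (A B : 'rV[F]_6).

Definition cf A (k : nat) : F := A ord0 (inord k).

Definition rv (z : nat -> F) : 'rV[F]_6 := \row_k z k.

Lemma cf_rv z k : (k < 6)%N -> cf (rv z) k = z k.
Proof. by move=> k6; rewrite /cf mxE inordK. Qed.

Lemma cf_inj A B : (forall k, (k < 6)%N -> cf A k = cf B k) -> A = B.
Proof.
by move=> E; apply/rowP => k; have := E k (ltn_ord k); rewrite /cf inord_val.
Qed.

Lemma cf_scroll_vec (x y : 'rV[F]_2) k : (k < 6)%N ->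
  cf (scroll_vec x y) k =
  scroll (x ord0 ord0) (x ord0 ord_max) (y ord0 ord0) (y ord0 ord_max) k.
Proof.
have i0 : inord 0 = ord0 :> 'I_2 by apply: val_inj; rewrite /= inordK.
have i1 : inord 1 = ord_max :> 'I_2 by apply: val_inj; rewrite /= inordK.
move=> k6; rewrite /cf mxE inordK //.
by do 6?[case: k k6 => [|k] k6] => //; rewrite /scroll ?i0 ?i1 /= ?i0 ?i1 /=;
  rewrite ?expr0 ?expr1 ?mulr1 ?mulrA.
Qed.

Lemma cf_wedge A B k : (k < 15)%N ->
  wedge A B ord0 (inord k) = wedgef (cf A) (cf B) k.
Proof.
move=> k15; rewrite mxE inordK //.
by do 15?[case: k k15 => [|k] k15].
Qed.

Definition squad_form (a b : nat) : {mpoly F[6]} :=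
  squad (fun k => 'X_(inord k)) a b.

Lemma squad_form_homog a b : squad_form a b \is 2.-homog.
Proof.
have Xh k : ('X_k : {mpoly F[6]}) \is 1.-homog by rewrite dhomogX /= mdeg1.
rewrite /squad_form /squad rpredB // (@dhomogM _ _ _ 1 _ 1) //;
by do 4?[case: a => [|a]]; do 4?[case: b => [|b]];
  rewrite /toprow /botrow /= ?nth_nil ?Xh ?dhomog0.
Qed.

Lemma mmap_squad_form (S : comNzRingType) (phi : {rmorphism F -> S}) (c : 'I_6 -> S) a b :
  mmap phi c (squad_form a b) = squad (fun k => c (inord k)) a b.
Proof.
rewrite /squad_form /squad rmorphB !rmorphM /=; congr (_ * _ - _ * _);
by do 4?[case: a => [|a]]; do 4?[case: b => [|b]];
  rewrite /toprow /botrow /= ?nth_nil ?mmapX ?mmap1U ?mmap0.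
Qed.

Lemma eq_squad (z w : nat -> F) a b : (forall k, (k < 6)%N -> z k = w k) ->
  squad z a b = squad w a b.
Proof. by move=> E; rewrite /squad /toprow /botrow !E. Qed.

Lemma eq_spolar (z w z' w' : nat -> F) a b : (forall k, (k < 6)%N -> z k = z' k) ->
  (forall k, (k < 6)%N -> w k = w' k) -> spolar z w a b = spolar z' w' a b.
Proof. by move=> E E'; rewrite /spolar /toprow /botrow !E ?E'. Qed.

Lemma squad_form_R4 a b : form_on (@R4 F) (squad_form a b).
Proof.
split=> [|P [x [y [_ _ EP]]]]; first by exists 2%N; apply: squad_form_homog.
apply/(vanishes_atE (squad_form_homog a b) EP).
rewrite /meval mmap_squad_form -[RHS](squad_scroll (x ord0 ord0) (x ord0 ord_max)
  (y ord0 ord0) (y ord0 ord_max) a b).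
by apply: eq_squad => k; apply: cf_scroll_vec.
Qed.

Lemma restr_squad_form A B a b : restr A B (squad_form a b) =
  (squad (cf A) a b)%:P + spolar (cf A) (cf B) a b *: 'X + squad (cf B) a b *: 'X^2.
Proof.
rewrite /restr mmap_squad_form.
have top c : toprow (fun k => linepar A B (inord k)) c =
    (toprow (cf A) c)%:P + (toprow (cf B) c)%:P * 'X.
  by do 4?[case: c => [|c]]; rewrite /toprow /linepar /= ?nth_nil ?mul_polyC
    ?scale0r ?addr0.
have bot c : botrow (fun k => linepar A B (inord k)) c =
    (botrow (cf A) c)%:P + (botrow (cf B) c)%:P * 'X.
  by do 4?[case: c => [|c]]; rewrite /botrow /linepar /= ?nth_nil ?mul_polyC
    ?scale0r ?addr0.
rewrite /squad /spolar !top !bot -!mul_polyC !(rmorphB, rmorphD, rmorphM, rmorphN) /=.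
ring.
Qed.

End ScrollPoints.

Section LineBases.
Variables (F : fieldType) (V : vectType F).
Implicit Types (A B : V).

Lemma span2_swap A B : <<[:: B; A]>>%VS = <<[:: A; B]>>%VS.
Proof. by apply: eq_span => v; rewrite !inE orbC. Qed.

Lemma span2_addr A B s : <<[:: (A + s *: B)%R; B]>>%VS = <<[:: A; B]>>%VS.
Proof.
apply/eqP; rewrite eqEsubv !span2_sub //.
- by apply/span2P; exists 1, s; rewrite scale1r.
- by apply/span2P; exists 0, 1; rewrite scale1r scale0r add0r.
- by apply/span2P; exists 1, (- s); rewrite scale1r scaleNr addrK.
by apply/span2P; exists 0, 1; rewrite scale1r scale0r add0r.
Qed.

Lemma span2_addl A B s : s != 0 -> <<[:: A; (A + s *: B)%R]>>%VS = <<[:: A; B]>>%VS.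
Proof.
move=> nz; apply/eqP; rewrite eqEsubv !span2_sub //.
- by apply/span2P; exists 1, 0; rewrite scale1r scale0r addr0.
- by apply/span2P; exists 1, s; rewrite scale1r.
- by apply/span2P; exists 1, 0; rewrite scale1r scale0r addr0.
apply/span2P; exists (- s^-1), s^-1; rewrite scalerDr scalerA mulVf // scale1r.
by rewrite scaleNr addrA addNr add0r.
Qed.

End LineBases.

(** * Every chord comes from the parametrization *)

Section Chords.
Variable F : numClosedFieldType.
Implicit Types (A B : 'rV[F]_6) (l : pline F 5).

Lemma squad_on_line A B a b s :
  squad (cf (A + s *: B)) a b = (restr A B (squad_form F a b)).[s].
Proof.
rewrite restr_horner /meval mmap_squad_form.
by apply: eq_squad => k k6.
Qed.

(** All quadrics restrict to multiples of one binary quadratic form, so its zeros lie on the scroll: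
    two distinct zeros give two points, a double zero gives tangency. If all restrictions are zero,
    any basis serves. *)
Lemma chord_classification l A0 B0 :
    is_chord (@R4 F) l -> val l = <<[:: A0; B0]>>%VS ->
  exists A B, [/\ val l = <<[:: A; B]>>%VS, forall a b, squad (cf A) a b = 0
    & (forall a b, squad (cf B) a b = 0) \/
      (forall a b, spolar (cf A) (cf B) a b = 0)].
Proof.
move=> lchord.
have prop A B a b c d : val l = <<[:: A; B]>>%VS ->
    restr A B (squad_form F a b) != 0 ->
    exists x, restr A B (squad_form F c d) = x *: restr A B (squad_form F a b).
  move=> lAB nz; apply: (chord_restr_proportional lAB lchord) nz;
  by [exact: squad_form_homog | exact: squad_form_R4].
have coefR A B a b : (restr A B (squad_form F a b))`_0 = squad (cf A) a b /\
   (restr A B (squad_form F a b))`_1 = spolar (cf A) (cf B) a b /\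
   (restr A B (squad_form F a b))`_2 = squad (cf B) a b.
  rewrite restr_squad_form !coefD !coefC !coefZ !coefX !coefXn /=.
  by rewrite !(mulr0, mulr1, addr0, add0r).
move=> lAB0.
have [A [B [lAB qA]]] : exists A B, val l = <<[:: A; B]>>%VS /\
    forall a b, squad (cf A) a b = 0.
  have [all0|/existsNP[a /existsNP[b /eqP nz]]] :=
      pselect (forall a b, restr A0 B0 (squad_form F a b) = 0).
    exists A0, B0; split=> // a b; case: (coefR A0 B0 a b) => <- _.
    by rewrite all0 coef0.
  (* A nonzero constant is a binary form with its only zero at infinity, that is at B0. *)
  have [s1|sn1] := eqVneq (size (restr A0 B0 (squad_form F a b))) 1%N.
    exists B0, A0; split; first by rewrite span2_swap.
    move=> c d; case: (coefR A0 B0 c d) => _ [_ <-].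
    have [x ->] := prop _ _ _ _ c d lAB0 nz.
    by rewrite coefZ [_`_2]nth_default ?s1 // mulr0.
  have /closed_rootP[s rs] := sn1.
  exists (A0 + s *: B0), B0; split; first by rewrite span2_addr.
  move=> c d; rewrite squad_on_line; have [x ->] := prop _ _ _ _ c d lAB0 nz.
  by rewrite hornerZ (rootP rs) mulr0.
have [all0|/existsNP[a /existsNP[b /eqP nz]]] :=
    pselect (forall a b, restr A B (squad_form F a b) = 0).
  exists A, B; split=> //; left=> a b; case: (coefR A B a b) => _ [_ <-].
  by rewrite all0 coef0.
have [B2|nzB] := eqVneq (squad (cf B) a b) 0.
  exists A, B; split=> //; left=> c d; case: (coefR A B c d) => _ [_ <-].
  have [x ->] := prop _ _ _ _ c d lAB nz.
  by rewrite coefZ; case: (coefR A B a b) => _ [_ ->]; rewrite B2 mulr0.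
(* As s = 0 is already a root, this is the other root of the restricted quadric; it is again 0 in
   the tangent case. *)
pose s := - spolar (cf A) (cf B) a b / squad (cf B) a b.
have [s0|nzs] := eqVneq s 0.
  exists A, B; split=> //; right=> c d; case: (coefR A B c d) => _ [<- _].
  have [x ->] := prop _ _ _ _ c d lAB nz; rewrite coefZ.
  case: (coefR A B a b) => _ [-> _].
  move/eqP: s0; rewrite mulf_eq0 invr_eq0 (negPf nzB) orbF oppr_eq0 => /eqP ->.
  by rewrite mulr0.
exists A, (A + s *: B); split=> //; first by rewrite span2_addl.
left=> c d; rewrite squad_on_line; have [x ->] := prop _ _ _ _ c d lAB nz.
rewrite hornerZ restr_squad_form qA !(hornerD, hornerC, hornerZ, hornerX, hornerXn).
by rewrite /s; field.
Qed.

Lemma wedge_comb A B a b c d :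
  wedge (a *: A + b *: B) (c *: A + d *: B) = (a * d - b * c) *: wedge A B.
Proof.
apply/rowP => k; rewrite !mxE; case: (nth _ _ _) => i j.
by rewrite !mxE; ring.
Qed.

Lemma wedge_secvar A B (p : nat -> F) P : hyp p = 0 ->
  (forall k, (k < 15)%N -> wedgef (cf A) (cf B) k = psi p k) ->
  val P = <[wedge A B]>%VS -> secvar P.
Proof.
move=> hp E EP; exists p; split=> //; rewrite EP; congr <[_]>%VS.
by apply/rowP => k; rewrite [RHS]mxE -E // -cf_wedge // inord_val.
Qed.

Lemma eq_wedgef (z w z' w' : nat -> F) k : (k < 15)%N ->
  (forall k, (k < 6)%N -> z k = z' k) -> (forall k, (k < 6)%N -> w k = w' k) ->
  wedgef z w k = wedgef z' w' k.
Proof. by move=> k15 E E'; rewrite /wedgef !E ?E'. Qed.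

Lemma M4_secvar (P : proj F 14) : M4 P -> secvar P.
Proof.
move=> [l [lchord [u [v [luv EP]]]]].
have [A [B [lAB qA qB]]] := chord_classification lchord luv.
have AB_free := line_free lAB.
have [nzA nzB] : A != 0 /\ B != 0.
  have n0 := free_not0 AB_free.
  by split; apply: n0; rewrite !inE eqxx ?orbT.
have {EP} EP : val P = <[wedge A B]>%VS.
  have /span2P[a [b Eu]] : u \in <<[:: A; B]>>%VS.
    by rewrite -lAB luv memv_span ?inE ?eqxx.
  have /span2P[c [d Ev]] : v \in <<[:: A; B]>>%VS.
    by rewrite -lAB luv memv_span ?inE ?eqxx ?orbT.
  have := proj_vec_neq0 EP; rewrite EP Eu Ev wedge_comb.
  set e := _ - _ => nz; have nze : e != 0.
    by apply: contra nz => /eqP ->; rewrite scale0r.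
  apply/eqP; rewrite eqEdim !dim_vline nz -memvE memvZ ?memv_line //=.
  by case: (_ == 0).
have coord_neq0 (C : 'rV[F]_6) : C != 0 -> exists2 k, (k < 6)%N & cf C k != 0.
  by move=> /rV0Pn[k nz]; exists (k : nat); rewrite ?ltn_ord // /cf inord_val.
have [x0 [x1 [y0 [y1 [nzx nzy EA]]]]] := squad0_scroll qA (coord_neq0 _ nzA).
case: qB => [qB|pB].
  have [x0' [x1' [y0' [y1' [_ _ EB]]]]] := squad0_scroll qB (coord_neq0 _ nzB).
  apply: wedge_secvar EP; first exact: (hyp_secpar x0 x1 y0 y1 x0' x1' y0' y1').
  by move=> k k15; rewrite -wedge_secant //; apply: eq_wedgef.
have [|x0' [x1' [z0 [z1 EB]]]] := @spolar0_tangent F x0 x1 y0 y1 (cf B) nzx nzy.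
  by move=> a b; rewrite -(pB a b); apply: eq_spolar => // k k6; rewrite EA.
apply: wedge_secvar EP; first exact: (hyp_tanpar x0 x1 y0 y1 x0' x1' z0 z1).
by move=> k k15; rewrite -wedge_tangent //; apply: eq_wedgef.
Qed.

End Chords.

Section BinaryForms.
Variable F : numClosedFieldType.

Lemma square_form (a b c : F) : b ^+ 2 = a * c ->
  exists x y, [/\ a = x ^+ 2, b = x * y & c = y ^+ 2].
Proof.
move=> E; have [a0|nza] := eqVneq a 0.
  exists 0, (sqrtC c); rewrite sqrtCK a0 expr0n mul0r; split=> //.
  by apply/eqP; rewrite -sqrf_eq0 E a0 mul0r.
have sa : sqrtC a ^+ 2 = a by rewrite sqrtCK.
have nzs : sqrtC a != 0 by rewrite sqrtC_eq0.
exists (sqrtC a), (b / sqrtC a); split; rewrite ?sa //; first by field.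
by rewrite expr_div_n sa E; field.
Qed.

Lemma factor_form (a b c : F) :
  exists y z y' z', [/\ a = y * y', b = y * z' + z * y' & c = z * z'].
Proof.
have [a0|nza] := eqVneq a 0.
  by exists 0, 1, b, c; rewrite a0 !mul0r !mul1r add0r.
have nz2 : (2 : F) != 0 by rewrite pnatr_eq0.
pose s := sqrtC (b ^+ 2 - 4 * a * c); have sE : s ^+ 2 = b ^+ 2 - 4 * a * c by rewrite sqrtCK.
exists a, ((b + s) / 2), 1, ((b - s) / (2 * a)); split; first by rewrite mulr1.
  by field.
have nz4 : 4 * a != 0 by rewrite mulf_neq0 // pnatr_eq0.
apply: (mulfI nz4); transitivity (b ^+ 2 - s ^+ 2); first by rewrite sE; ring.
by field.
Qed.

Lemma det2_surj (a b c : F) : (a != 0) || (b != 0) ->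
  exists x y, a * y - b * x = c.
Proof.
case/orP=> nz; first by exists 0, (c / a); field.
by exists (- c / b), 0; field.
Qed.

End BinaryForms.

(** * Every point of the parametrization is a chord *)

Section Converse.
Variable F : numClosedFieldType.
Implicit Types (A B : 'rV[F]_6).

Definition row2 (a b : F) : 'rV[F]_2 := \row_i (if i == ord0 then a else b).

Lemma row2_neq0 a b : (a != 0) || (b != 0) -> row2 a b != 0.
Proof.
move=> H; apply/rV0Pn; case/orP: H => nz; [exists ord0 | exists ord_max];
by rewrite mxE.
Qed.

Lemma rv_scroll x0 x1 y0 y1 :
  rv (scroll x0 x1 y0 y1) = scroll_vec (row2 x0 x1) (row2 y0 y1).
Proof.
by apply: cf_inj => k k6; rewrite cf_rv // cf_scroll_vec // !mxE.
Qed.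

(** Degenerate parameters giving the zero vector are allowed, so the statement applies along entire
    polynomial curves. *)
Lemma R4_form_vanish f x0 x1 y0 y1 : form_on (@R4 F) f ->
  f.@[rv (scroll x0 x1 y0 y1) ord0] = 0.
Proof.
move=> [ff f0]; have [v0|nz] := eqVneq (rv (scroll x0 x1 y0 y1)) 0.
  have [P RP] : exists P : proj F 5, R4 P.
    have nz : rv (scroll (1 : F) 0 1 0) != 0.
      apply/rV0Pn; exists ord0.
      by rewrite mxE /scroll /= expr1n mulr1 oner_eq0.
    have [P EP] := proj_of_vec nz; exists P; exists (row2 1 0), (row2 1 0).
    by rewrite !row2_neq0 ?oner_eq0 // EP rv_scroll.
  have E := vanishing_form0 RP f0; rewrite -[RHS]E; apply: meval_eq => k.
  by rewrite v0 mxE.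
have [P EP] := proj_of_vec nz; apply: (f0 P); last by rewrite EP memv_line.
have nzx : row2 x0 x1 != 0.
  apply: contra nz => /eqP x00; rewrite rv_scroll x00; apply/eqP/rowP => k.
  by rewrite !mxE !mul0r.
exists (row2 x0 x1), (row2 y0 y1); split=> //; last by rewrite EP rv_scroll.
apply: contra nz => /eqP y00; rewrite rv_scroll y00; apply/eqP/cf_inj => k k6.
rewrite cf_scroll_vec // /cf !mxE; do 6?[case: k k6 => [|k] k6] => //;
by rewrite /scroll /= ?expr0n ?mulr0.
Qed.

Lemma wedge_neq0_free A B : wedge A B != 0 -> free [:: A; B].
Proof.
move=> nz; rewrite free_cons span_seq1 seq1_free; apply/andP; split.
  apply: contra nz => /vlineP[c ->]; apply/eqP/rowP => k.
  by rewrite !mxE; case: (nth _ _ _) => i j; rewrite !mxE; ring.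
apply: contra nz => /eqP ->; apply/eqP/rowP => k.
by rewrite !mxE; case: (nth _ _ _) => i j; rewrite !mxE; ring.
Qed.

Lemma M4_of_modulus A B D (g : {poly F}) P : val P = <[wedge A B]>%VS ->
    size g = 3%N -> <<[:: A; D]>>%VS = <<[:: A; B]>>%VS ->
    (forall f, form_on (@R4 F) f -> g %| restr A D f) -> M4 P.
Proof.
move=> EP sg sp gX; have AB_free := wedge_neq0_free (proj_vec_neq0 EP).
have dl : \dim <<[:: A; B]>>%VS == 2%N by move: AB_free; rewrite /free.
pose l : pline F 5 := exist _ <<[:: A; B]>>%VS dl.
exists l; split; last by exists A, B.
by apply: (@is_chord_of_modulus F 5 (@R4 F) l A D _ g sg gX); rewrite sp.
Qed.

Lemma M4_secant x0 x1 y0 y1 x0' x1' y0' y1' (P : proj F 14) :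
  val P = <[psiv (secpar x0 x1 y0 y1 x0' x1' y0' y1')]>%VS -> M4 P.
Proof.
pose A := rv (scroll x0 x1 y0 y1); pose B := rv (scroll x0' x1' y0' y1').
move=> EP; have {EP} EP : val P = <[wedge A B]>%VS.
  rewrite EP; congr <[_]>%VS; apply/rowP => k.
  rewrite mxE -wedge_secant ?ltn_ord // -[in RHS](inord_val k) cf_wedge ?ltn_ord //.
  by apply: eq_wedgef => // i i6; rewrite cf_rv.
have sg : size ('X * ('X - 1%:P) : {poly F}) = 3%N.
  by rewrite size_mul ?polyX_eq0 ?polyXsubC_eq0 // size_polyX size_XsubC.
(* With direction B - A the two points have the finite parameters 0 and 1; with direction B the
   second one would be at infinity. *)
apply: (M4_of_modulus (D := B - A) EP sg).
  by rewrite span2_swap -[B - A]/(B - A) -scaleN1r span2_addr span2_swap.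
move=> f fR; have rootr a : a = 0 \/ a = 1 -> root (restr A (B - A) f) a.
  move=> a01; apply/rootP; rewrite restr_horner; case: a01 => ->.
    by rewrite scale0r addr0 R4_form_vanish.
  by rewrite scale1r addrC subrK R4_form_vanish.
have r0 := rootr 0 (or_introl erefl); have r1 := rootr 1 (or_intror erefl).
rewrite Gauss_dvdp.
  by move: r0; rewrite -!dvdp_XsubCl polyC0 subr0 => ->; rewrite dvdp_XsubCl.
have := @coprimep_XsubC2 F 0 1; rewrite polyC0 !subr0; apply.
by rewrite oner_eq0.
Qed.

Lemma M4_tangent x0 x1 y0 y1 x0' x1' z0 z1 (P : proj F 14) :
  val P = <[psiv (tanpar x0 x1 y0 y1 x0' x1' z0 z1)]>%VS -> M4 P.
Proof.
pose A := rv (scroll x0 x1 y0 y1); pose B := rv (scroll_tan x0 x1 y0 y1 x0' x1' z0 z1).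
move=> EP; have {EP} EP : val P = <[wedge A B]>%VS.
  rewrite EP; congr <[_]>%VS; apply/rowP => k.
  rewrite mxE -wedge_tangent ?ltn_ord // -[in RHS](inord_val k) cf_wedge ?ltn_ord //.
  by apply: eq_wedgef => // i i6; rewrite cf_rv.
apply: (M4_of_modulus (D := B) (g := 'X^2) EP (size_polyXn _ _)) => // f fR.
(* A curve on the scroll that agrees with A + s B modulo s^2. Forms of the ideal vanish along it, so
   their restrictions to the line are divisible by s^2. *)
pose c (k : 'I_6) : {poly F} := scroll (x0%:P + x0' *: 'X) (x1%:P + x1' *: 'X)
  (y0%:P + z0 *: 'X) (y1%:P + z1 *: 'X) k.
have cE k : exists r, c k = linepar A B k + r * 'X^2.
  rewrite /c /linepar /A /B !mxE -!mul_polyC.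
  pose X : {poly F} := 'X.
  case: k => k k6; do 6?[case: k k6 => [|k] k6] => //=; rewrite /scroll_tan /scroll /=
    !(rmorphD, rmorphM, rmorphXn, rmorph_nat) /=.
  - exists (x0%:P * z0%:P ^+ 2 + x0'%:P * (2 * y0%:P * z0%:P + z0%:P ^+ 2 * X)); rewrite /X; ring.
  - exists (x0%:P * z0%:P * z1%:P + x0'%:P * (y0%:P * z1%:P + y1%:P * z0%:P + z0%:P * z1%:P * X)); rewrite /X; ring.
  - exists (x0%:P * z1%:P ^+ 2 + x0'%:P * (2 * y1%:P * z1%:P + z1%:P ^+ 2 * X)); rewrite /X; ring.
  - exists (x1%:P * z0%:P ^+ 2 + x1'%:P * (2 * y0%:P * z0%:P + z0%:P ^+ 2 * X)); rewrite /X; ring.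
  - exists (x1%:P * z0%:P * z1%:P + x1'%:P * (y0%:P * z1%:P + y1%:P * z0%:P + z0%:P * z1%:P * X)); rewrite /X; ring.
  - exists (x1%:P * z1%:P ^+ 2 + x1'%:P * (2 * y1%:P * z1%:P + z1%:P ^+ 2 * X)); rewrite /X; ring.
have coef_c k i : (i < 2)%N -> (c k)`_i = (linepar A B k)`_i.
  by move=> i2; have [r ->] := cE k; rewrite coefD coefMXn i2 addr0.
have c0 : mmap polyC c f = 0.
  apply: poly_zero_fun => a; rewrite mmap_hornerE.
  rewrite -[RHS](R4_form_vanish (x0 + x0' * a) (x1 + x1' * a) (y0 + z0 * a) (y1 + z1 * a) fR).
  apply: meval_eq => k; rewrite mxE /c; case: k => k k6 /=.
  by do 6?[case: k k6 => [|k] k6] => //; rewrite /scroll /= !hornerE.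
have r0 : (restr A B f)`_0 = 0.
  rewrite -horner_coef0 /restr mmap_hornerE -[RHS](coef0 _ 0) -c0 -horner_coef0 mmap_hornerE.
  by apply: meval_eq => k; rewrite !horner_coef0 coef_c.
have r1 : (restr A B f)`_1 = 0.
  rewrite /restr deriv_mmap0 -[RHS](coef0 _ 1) -c0 deriv_mmap0.
  apply: eq_bigr => k _; rewrite coef_c //; congr (_ * _).
  by apply: meval_eq => j; rewrite coef_c.
apply/dvdpP; exists (\poly_(i < size (restr A B f)) (restr A B f)`_i.+2).
apply/polyP => i; rewrite coefMXn coef_poly; case: i => [|[|i]] //=.
rewrite subSS subSS subn0; case: ltnP => // si.
by rewrite nth_default // (leq_trans si) // leqW // leqW.
Qed.

(** Factor q = y y'. If disc q <> 0, factoring t / [y, y'] gives x and x' with [x, x'] = 2 l up to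
    sign. If disc q = 0, both q and t are squares, which gives a tangent line or a ruling. *)
Lemma secvar_M4 (P : proj F 14) : secvar P -> M4 P.
Proof.
move=> [p [hp EP]]; have nz2 : (2 : F) != 0 by rewrite pnatr_eq0.
have nz4 : (4 : F) != 0 by rewrite pnatr_eq0.
have psiE p' : (forall i, (i < 7)%N -> p i = p' i) -> val P = <[psiv p']>%VS.
  by move=> E; rewrite EP; congr <[_]>%VS; apply/rowP => k; rewrite !mxE /psi !E.
have hypE : p 5 ^+ 2 = p 4 * p 6 + p 3 ^+ 2 * (p 1 ^+ 2 - 4 * p 0 * p 2).
  by apply/eqP; rewrite -subr_eq0 -[X in _ == X]hp /hyp; apply/eqP; ring.
have [y0 [y1 [y0' [y1' [q0 q1 q2]]]]] := factor_form (p 0) (p 1) (p 2).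
pose d := y0 * y1' - y1 * y0'.
have dE : d ^+ 2 = p 1 ^+ 2 - 4 * p 0 * p 2 by rewrite q0 q1 q2 /d; ring.
have [d0|nzd] := eqVneq d 0; last first.
  have [x0 [x1 [x0' [x1' [t0 t1 t2]]]]] := factor_form (p 4 / d) (2 * p 5 / d) (p 6 / d).
  have : (x0 * x1' - x1 * x0') ^+ 2 = (2 * p 3) ^+ 2.
    have -> : (x0 * x1' - x1 * x0') ^+ 2 =
      (x0 * x1' + x1 * x0') ^+ 2 - 4 * (x0 * x0') * (x1 * x1') by ring.
    rewrite -t0 -t1 -t2; apply: (mulIf (expf_neq0 2 nzd)).
    transitivity (4 * (p 5 ^+ 2 - p 4 * p 6)); first by field.
    by rewrite hypE dE; ring.
  have T0 : p 4 = d * (x0 * x0') by rewrite -t0; field.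
  have T1 : p 5 = d * (x0 * x1' + x1 * x0') / 2 by rewrite -t1; field.
  have T2 : p 6 = d * (x1 * x1') by rewrite -t2; field.
  move/eqP; rewrite eqf_sqr => /orP[] /eqP L.
    apply: (@M4_secant x0 x1 y0 y1 x0' x1' y0' y1'); apply: psiE => i.
    do 7?[case: i => [|i]] => // _; rewrite /secpar /= -/d ?T0 ?T1 ?T2 //.
    by rewrite L; field.
  (* Exchanging x and x' changes the sign of l and keeps q and t. *)
  apply: (@M4_secant x0' x1' y0 y1 x0 x1 y0' y1'); apply: psiE => i.
  do 7?[case: i => [|i]] => // _; rewrite /secpar /= -/d ?T0 ?T1 ?T2 //; try by field.
  have -> : x0' * x1 - x1' * x0 = - (x0 * x1' - x1 * x0') by ring.
  by rewrite L; field.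
have dq0 : p 1 ^+ 2 - 4 * p 0 * p 2 = 0 by rewrite -dE d0 expr0n.
have [|w0 [w1 [Q0 Q1 Q2]]] := @square_form F (p 0) (p 1 / 2) (p 2).
  have E : p 1 ^+ 2 = 4 * p 0 * p 2 by apply/eqP; rewrite -subr_eq0 dq0.
  by rewrite expr_div_n E; field.
have [|x0 [x1 [T0 T1 T2]]] := @square_form F (p 4) (p 5) (p 6).
  by rewrite hypE dq0 mulr0 addr0.
have Q1' : p 1 = 2 * w0 * w1 by rewrite -mulrA -Q1; field.
have [/andP[/eqP x00 /eqP x10]|] := boolP ((x0 == 0) && (x1 == 0)).
  (* For t = 0 the direction in y is zero: the line is a ruling of the scroll, with x = (1, 0) and
     x' = (0, 2 l). *)
  apply: (@M4_tangent 1 0 w0 w1 0 (2 * p 3) 0 0); apply: psiE => i.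
  by do 7?[case: i => [|i]] => // _; rewrite /tanpar /= ?T0 ?T1 ?T2 ?x00 ?x10 //; field.
rewrite negb_and => nzx; have nzw : (w0 != 0) || (w1 != 0).
  apply: contraNT (proj_vec_neq0 EP); rewrite negb_or !negbK => /andP[/eqP w00 /eqP w10].
  apply/eqP/rowP => k; rewrite !mxE /psi Q0 Q1' Q2 w00 w10.
  case: k => k k15; do 15?[case: k k15 => [|k] k15] => //=; ring.
have [x0' [x1' X']] := det2_surj (2 * p 3) nzx.
have [z0 [z1 Z']] := det2_surj 1 nzw.
apply: (@M4_tangent x0 x1 w0 w1 x0' x1' z0 z1); apply: psiE => i.
do 7?[case: i => [|i]] => // _; rewrite /tanpar /= ?T0 ?T1 ?T2 ?Z' ?mul1r //.
by rewrite X'; field.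
Qed.

Lemma M4E : @M4 F = @secvar F.
Proof. by apply: funext => P; apply: propext; split; [apply: M4_secvar | apply: secvar_M4]. Qed.

Lemma M4_proposition :
  psub (@M4 F) (@grassmannian F) /\ zclosed (@M4 F) /\ zirreducible (@M4 F) /\
  has_dim (@M4 F) 4 /\ smooth (@M4 F).
Proof.
split; first by move=> P [l [_ lP]]; exists l.
rewrite M4E; split; first exact: secvar_closed.
split; first exact: secvar_irreducible.
split; first exact: secvar_has_dim.
exists 4%N; split; first exact: secvar_has_dim.
exact: secvar_tangent_dim.
Qed.

End Converse.

Theorem proposition2p1 (R : realType) :
  psub (@M4 R[i]) (@grassmannian R[i]) /\
  zclosed (@M4 R[i]) /\
  zirreducible (@M4 R[i]) /\
  has_dim (@M4 R[i]) 4 /\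
  smooth (@M4 R[i]).
Proof. exact: M4_proposition. Qed.
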